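(* Let $M$ be a smooth $n$-dimensional manifold and let $\mathcal{H}$ be a horizontal distribution on $J^{1\ast}(\mathbb{R},M)$. Let $\pi^{\ast}:J^{1\ast}(\mathbb{R},M)\to\mathbb{R}\times M$ be the canonical projection and $\pi^{\ast}{}_{\ast}$ its differential. (i) On the domain of each induced coordinate chart $(t,x^i,p_i^1)$ there exist unique linearly independent horizontal vector fields $\dfrac{\delta}{\delta t},\dfrac{\delta}{\delta x^i}\in\mathcal{S}(\mathcal{H})$, $i=1,\ldots,n$, having the properties $$\pi^{\ast}{}_{\ast}\left(\frac{\delta}{\delta t}\right)=\frac{\partial}{\partial t},\qquad \pi^{\ast}{}_{\ast}\left(\frac{\delta}{\delta x^i}\right)=\frac{\partial}{\partial x^i}.$$ (ii) The horizontal vector fields $\dfrac{\delta}{\delta t}$ and $\dfrac{\delta}{\delta x^i}$ can be uniquely written in the form $$\frac{\delta}{\delta t}=\frac{\partial}{\partial t}-\underset{1}{N}{}_{(j)1}^{(1)}\frac{\partial}{\partial p_j^1},\qquad \frac{\delta}{\delta x^i}=\frac{\partial}{\partial x^i}-\underset{2}{N}{}_{(j)i}^{(1)}\frac{\partial}{\partial p_j^1}.$$ (iii) Under changes of induced coordinates, the local coefficients $\underset{1}{N}{}_{(j)1}^{(1)}$ and $\underset{2}{N}{}_{(j)i}^{(1)}$ obey the transformation rules $$\underset{1}{\widetilde N}{}_{(j)1}^{(1)}=\underset{1}{N}{}_{(k)1}^{(1)}\frac{\partial x^k}{\partial\tilde x^j}-\frac{dt}{d\tilde t}\frac{\partial\tilde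 p_j^1}{\partial t},\qquad \underset{2}{\widetilde N}{}_{(j)r}^{(1)}=\underset{2}{N}{}_{(k)i}^{(1)}\frac{d\tilde t}{dt}\frac{\partial x^k}{\partial\tilde x^j}\frac{\partial x^i}{\partial\tilde x^r}-\frac{\partial x^i}{\partial\tilde x^r}\frac{\partial\tilde p_j^1}{\partial x^i}$$ of a nonlinear connection $N$ on $J^{1\ast}(\mathbb{R},M)$. (iv) To give a horizontal distribution $\mathcal{H}$ on $J^{1\ast}(\mathbb{R},M)$ is equivalent to giving a nonlinear connection $N=\left(\underset{1}{N}{}_{(j)1}^{(1)},\underset{2}{N}{}_{(j)i}^{(1)}\right)$ on $J^{1\ast}(\mathbb{R},M)$; that is, the assignment $\mathcal{H}\mapsto N$ given by (i)–(iii) is a bijection between horizontal distributions and nonlinear connections on $J^{1\ast}(\mathbb{R},M)$.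
   Context: Everything is smooth; the summation convention over repeated indices $i,j,k,\ldots\in\{1,\ldots,n\}$ is used. The index $1$ is a label attached to the one-dimensional time coordinate. The dual 1-jet space $J^{1\ast}(\mathbb{R},M)\equiv\mathbb{R}\times T^{\ast}M\to\mathbb{R}\times M$ is the rank-$n$ vector bundle over $\mathbb{R}\times M$ with local coordinates $(t,x^i,p_i^1)$, where $t$ is a local coordinate on $\mathbb{R}$, $(x^i)$ are local coordinates on $M$, and changes of coordinates $t\mapsto\tilde t$ on $\mathbb{R}$ and $x\mapsto\tilde x$ on $M$ induce the change of coordinates $$\tilde t=\tilde t(t),\qquad \tilde x^i=\tilde x^i(x^j),\qquad \tilde p_i^1=\frac{\partial x^j}{\partial\tilde x^i}\frac{d\tilde t}{dt}\,p_j^1,$$ with $d\tilde t/dt\neq0$ and $\det(\partial\tilde x^i/\partial x^j)\neq0$. (Equivalently, the fibre over $(t,x)$ is $T^{\ast}_xM\otimes T_t\mathbb{R}$.) Here $\partial\tilde p_j^1/\partial t$ and $\partial\tilde p_j^1/\partial x^i$ are the partial derivatives of $\tilde p_j^1$ viewed as a function of $(t,x,p)$ through this formula. Tildes denote components in the new coordinates. The canonical projection is $\pi^{\ast}(t,x,p)=(t,x)$. The vertical distribution $\mathcal{W}$ assigns to $u^{\ast}\in J^{1\ast}(\mathbb{R},M)$ the subspace $W_{u^{\ast}}=\ker\left(\pi^{\ast}{}_{\ast,u^{\ast}}\right)\subset T_{u^{\ast}}J^{1\ast}(\mathbb{R},M)$, which has basis $\{\partial/\partial p_i^1|_{u^{\ast}}\}$.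 A horizontal distribution is a smooth distribution $\mathcal{H}:u^{\ast}\mapsto H_{u^{\ast}}\subset T_{u^{\ast}}J^{1\ast}(\mathbb{R},M)$ such that $T_{u^{\ast}}J^{1\ast}(\mathbb{R},M)=H_{u^{\ast}}\oplus W_{u^{\ast}}$ for all $u^{\ast}\in J^{1\ast}(\mathbb{R},M)$. $\mathcal{S}(\mathcal{H})$ denotes the set of smooth sections of $\mathcal{H}$ (horizontal vector fields). A nonlinear connection on $J^{1\ast}(\mathbb{R},M)$ is a pair $N=\left(\underset{1}{N}{}_{(k)1}^{(1)},\underset{2}{N}{}_{(k)i}^{(1)}\right)$ of families of smooth functions, given on the domain of each induced coordinate chart, which transform under the changes of coordinates $\tilde t=\tilde t(t)$, $\tilde x^i=\tilde x^i(x^j)$, $\tilde p_i^1=\frac{\partial x^j}{\partial\tilde x^i}\frac{d\tilde t}{dt}\,p_j^1$ by the two rules $$\underset{1}{\widetilde N}{}_{(j)1}^{(1)}=\underset{1}{N}{}_{(k)1}^{(1)}\frac{\partial x^k}{\partial\tilde x^j}-\frac{dt}{d\tilde t}\frac{\partial\tilde p_j^1}{\partial t},\qquad \underset{2}{\widetilde N}{}_{(j)r}^{(1)}=\underset{2}{N}{}_{(k)i}^{(1)}\frac{d\tilde t}{dt}\frac{\partial x^k}{\partial\tilde x^j}\frac{\partial x^i}{\partial\tilde x^r}-\frac{\partial x^i}{\partial\tilde x^r}\frac{\partial\tilde p_j^1}{\partial x^i}.$$ *)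

(* Defs.v *)
From mathcomp Require Import all_boot all_order all_algebra.
From mathcomp Require Import all_classical all_reals all_analysis.
Set Implicit Arguments.
Unset Strict Implicit.
Unset Printing Implicit Defensive.
Import Order.TTheory GRing.Theory Num.Theory.
Import numFieldNormedType.Exports.
Local Open Scope classical_set_scope.
Local Open Scope ring_scope.

(* In finite dimension, Df is of class C^k iff every x |-> Df(x) v is. *)
Fixpoint Ck_on (R : realType) (V W : normedModType R) (k : nat)
    (U : set V) (f : V -> W) : Prop :=
  match k with
  | 0 => forall x, U x -> {for x, continuous f}
  | k'.+1 => (forall x, U x -> differentiable f x) /\
             (forall v : V, Ck_on k' U (fun x => 'd f x v))
  end.

Definition smooth_on (R : realType) (V W : normedModType R)
    (U : set V) (f : V -> W) : Prop :=
  open U /\ forall k, Ck_on k U f.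

(* The values of [crd] outside [dom] are irrelevant. *)
Record chart (R : realType) (V : normedModType R) (X : Type) :=
  Chart { dom : set X ; crd :> X -> V }.

(* The coordinate expression f o c^-1 of f, extended by 0 outside the image
   of the chart, so that no inverse of c on all of V has to be chosen. *)
Definition on_chart (R : realType) (V W : normedModType R) (X : Type)
    (c : chart V X) (f : X -> W) : V -> W := fun z =>
  match pselect (exists u, dom c u /\ c u = z) with
  | left e => f (sval (cid e))
  | right _ => 0
  end.

Definition compatible (R : realType) (V : normedModType R) (X : Type)
    (c d : chart V X) : Prop :=
  smooth_on (c @` (dom c `&` dom d)) (on_chart c d) /\
  smooth_on (d @` (dom c `&` dom d)) (on_chart d c).

(* A homeomorphism from an open set onto an open subset of V. *)
Definition topological_chart (R : realType) (V : normedModType R)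
    (T : topologicalType) (c : chart V T) : Prop :=
  [/\ open (dom c), set_inj (dom c) c,
      forall x, dom c x -> {for x, continuous c} &
      forall U, open U -> U `<=` dom c -> open (c @` U)].

(* The atlas is maximal: its members are all the local coordinate systems. *)
Record manifold (R : realType) (n : nat) := Manifold {
  carrier :> topologicalType ;
  atlas : set (chart 'rV[R]_n carrier) ;
  manifold_hausdorff : hausdorff_space carrier ;
  manifold_second_countable : @second_countable carrier ;
  atlas_topological : forall c, atlas c -> topological_chart c ;
  atlas_cover : forall x : carrier, exists2 c, atlas c & dom c x ;
  atlas_compatible : forall c d, atlas c -> atlas d -> compatible c d ;
  atlas_maximal : forall c, topological_chart c ->
    (forall d, atlas d -> compatible c d) -> atlas c }.

(* Local coordinates on the real line: the maximal atlas of the identity. *)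
Definition time_chart (R : realType) (c : chart R R) : Prop :=
  topological_chart c /\ compatible (Chart setT (fun t : R => t)) c.

Record charted (R : realType) (V : normedModType R) := Charted {
  point :> Type ;
  label : Type ;
  chart_of : label -> chart V point }.

Arguments chart_of {R V} X _ : rename.

Notation cdom X c := (dom (chart_of X c)).

(* A tangent vector is the family of its components in all charts at the base
   point; entries at the other charts are set to 0, so that two tangent vectors
   at u are the same exactly when they are equal as families. *)
Notation tvec X V := (label X -> V).

Definition tangent (R : realType) (V : normedModType R) (X : charted V)
    (u : X) : set (tvec X V) :=
  [set v | (forall c, ~ cdom X c u -> v c = 0) /\
     forall c d, cdom X c u -> cdom X d u ->
       v d = 'd (on_chart (chart_of X c) (chart_of X d))
                (chart_of X c u) (v c)].

(* The tangent vector at u whose component in the chart c is e. *)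
Definition coord_vec (R : realType) (V : normedModType R) (X : charted V)
    (c : label X) (e : V) (u : X) : tvec X V := fun d =>
  if `[< cdom X c u /\ cdom X d u >] then
    'd (on_chart (chart_of X c) (chart_of X d)) (chart_of X c u) e
  else 0.

(* f_{*,u}; any chart c around u may be used to compute it. *)
Definition differential (R : realType) (V W : normedModType R)
    (X : charted V) (Y : charted W) (f : X -> Y) (u : X)
    (v : tvec X V) : tvec Y W := fun d =>
  match pselect (exists c, cdom X c u) with
  | left e =>
      let c := sval (cid e) in
      if `[< cdom Y d (f u) >] then
        'd (on_chart (chart_of X c) (fun y => chart_of Y d (f y)))
           (chart_of X c u) (v c)
      else 0
  | right _ => 0
  end.

Definition chart_open (R : realType) (V : normedModType R) (X : charted V)
    (U : set X) : Prop :=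
  forall c, open (chart_of X c @` (U `&` cdom X c)).

Definition smooth_fun (R : realType) (V W : normedModType R) (X : charted V)
    (U : set X) (f : X -> W) : Prop :=
  forall c, smooth_on (chart_of X c @` (U `&` cdom X c))
                      (on_chart (chart_of X c) f).

Definition smooth_field (R : realType) (V : normedModType R) (X : charted V)
    (U : set X) (Y : X -> tvec X V) : Prop :=
  (forall u, U u -> tangent u (Y u)) /\
  forall c, smooth_on (chart_of X c @` (U `&` cdom X c))
                      (on_chart (chart_of X c) (fun u => Y u c)).

Definition smooth_section (R : realType) (V : normedModType R) (X : charted V)
    (H : X -> set (tvec X V)) (U : set X) (Y : X -> tvec X V) : Prop :=
  smooth_field U Y /\ forall u, U u -> H u (Y u).

Definition smooth_distribution (R : realType) (V : normedModType R)
    (X : charted V) (H : X -> set (tvec X V)) : Prop :=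
  (forall u, [/\ H u `<=` tangent u, H u 0 &
     forall (a : R) v w, H u v -> H u w -> H u (a *: v + w)]) /\
  forall u, exists (U : set X) (k : nat) (Y : 'I_k -> X -> tvec X V),
    [/\ chart_open U, U u,
        forall i, smooth_section H U (Y i) &
        forall y, U y ->
          (forall a : 'I_k -> R, \sum_i a i *: Y i y = 0 -> forall i, a i = 0) /\
          (forall v, H y v -> exists a : 'I_k -> R, v = \sum_i a i *: Y i y)].

(* A pair of a local coordinate on the line and local coordinates on M. *)
Definition jet_label (R : realType) (n : nat) (M : manifold R n) : Type :=
  ({c : chart R R | time_chart c} * {c | @atlas R n M c})%type.

Definition time_of (R : realType) (n : nat) (M : manifold R n)
  (c : jet_label M) : chart R R := sval c.1.

Definition space_of (R : realType) (n : nat) (M : manifold R n)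
  (c : jet_label M) : chart 'rV[R]_n M := sval c.2.

Definition base_chart (R : realType) (n : nat) (M : manifold R n)
    (c : jet_label M) : chart (R * 'rV[R]_n)%type (R * M)%type :=
  Chart (dom (time_of c) `*` dom (space_of c))
        (fun q => (time_of c q.1, space_of c q.2)).

Definition base_space (R : realType) (n : nat) (M : manifold R n)
    : charted (R * 'rV[R]_n)%type :=
  @Charted R _ (R * M)%type (jet_label M) (@base_chart R n M).

(* d t_d / d t_c *)
Definition dT (R : realType) (n : nat) (M : manifold R n)
    (c d : jet_label M) (q : R * M) : R :=
  derive1 (on_chart (time_of c) (time_of d)) (time_of c q.1).

(* d x_d^i / d x_c^j *)
Definition dX (R : realType) (n : nat) (M : manifold R n)
    (c d : jet_label M) (q : R * M) (i j : 'I_n) : R :=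
  ('D_(delta_mx 0 j) (on_chart (space_of c) (space_of d)) (space_of c q.2)) 0 i.

(* Points (t, x, p) with p in T*_x M (x) T_t R, given by its components in every
   pair of charts at (t, x) (and 0 at the other pairs of charts). *)
Record dual_jet (R : realType) (n : nat) (M : manifold R n) := DualJet {
  base_pt : R * M ;
  mom : jet_label M -> 'rV[R]_n ;
  mom_off : forall c, ~ dom (base_chart c) base_pt -> mom c = 0 ;
  mom_change : forall c d, dom (base_chart c) base_pt -> dom (base_chart d) base_pt ->
    forall i, mom d 0 i =
      \sum_(j < n) dX d c base_pt j i * dT c d base_pt * mom c 0 j }.

Definition jet_model (R : realType) (n : nat) : normedModType R :=
  (R * 'rV[R]_n * 'rV[R]_n)%type.

Definition jet_chart (R : realType) (n : nat) (M : manifold R n)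
    (c : jet_label M) : chart (jet_model R n) (dual_jet M) :=
  Chart [set u | dom (base_chart c) (base_pt u)]
        (fun u => (time_of c (base_pt u).1, space_of c (base_pt u).2, mom u c)).

Definition jet_space (R : realType) (n : nat) (M : manifold R n)
    : charted (jet_model R n) :=
  Charted (@jet_chart R n M).

Definition pi_star (R : realType) (n : nat) (M : manifold R n)
  (u : jet_space M) : base_space M := base_pt u.

Notation jet_tvec M := (tvec (jet_space M) (jet_model _ _)).

Definition dir_t (R : realType) (n : nat) : jet_model R n := (1, 0, 0).
Definition dir_x (R : realType) (n : nat) (i : 'I_n) : jet_model R n :=
  (0, delta_mx 0 i, 0).
Definition dir_p (R : realType) (n : nat) (i : 'I_n) : jet_model R n :=
  (0, 0, delta_mx 0 i).

Definition vertical (R : realType) (n : nat) (M : manifold R n)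
    (u : jet_space M) : set (jet_tvec M) :=
  [set w | tangent u w /\ differential (@pi_star R n M) u w = 0].

Definition horizontal_distribution (R : realType) (n : nat) (M : manifold R n)
    (H : jet_space M -> set (jet_tvec M)) : Prop :=
  smooth_distribution H /\
  forall u, tangent u = [set h + w | h in H u & w in vertical u] /\
            H u `&` vertical u = [set 0].

(* [dt] and [dx i] are delta/delta t and delta/delta x^i on the domain of c. *)
Definition adapted_fields (R : realType) (n : nat) (M : manifold R n)
    (H : jet_space M -> set (jet_tvec M)) (c : jet_label M)
    (dt : jet_space M -> jet_tvec M)
    (dx : 'I_n -> jet_space M -> jet_tvec M) : Prop :=
  [/\ smooth_section H (cdom (jet_space M) c) dt,
      forall i, smooth_section H (cdom (jet_space M) c) (dx i),
      forall u, cdom (jet_space M) c u -> forall (a : R) (b : 'I_n -> R),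
        a *: dt u + \sum_i b i *: dx i u = 0 -> a = 0 /\ forall i, b i = 0,
      forall u, cdom (jet_space M) c u ->
        differential (@pi_star R n M) u (dt u) =
        @coord_vec R _ (base_space M) c (1, 0) (pi_star u) &
      forall i u, cdom (jet_space M) c u ->
        differential (@pi_star R n M) u (dx i u) =
        @coord_vec R _ (base_space M) c (0, delta_mx 0 i) (pi_star u)].

Definition expansion (R : realType) (n : nat) (M : manifold R n)
    (c : jet_label M) (dt : jet_space M -> jet_tvec M)
    (dx : 'I_n -> jet_space M -> jet_tvec M)
    (N1 : jet_space M -> 'rV[R]_n) (N2 : jet_space M -> 'M[R]_n) : Prop :=
  forall u, cdom (jet_space M) c u ->
    dt u = @coord_vec R _ (jet_space M) c (dir_t R n) u
           - \sum_j N1 u 0 j *: @coord_vec R _ (jet_space M) c (dir_p R j) u /\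
    forall i, dx i u = @coord_vec R _ (jet_space M) c (dir_x R i) u
           - \sum_j N2 u j i *: @coord_vec R _ (jet_space M) c (dir_p R j) u.

(* A pair (N_1, N_2) of families indexed by the induced charts; N_2 is stored
   with its covector index k as row and its index i as column. *)
Definition coeffs (R : realType) (n : nat) (M : manifold R n) : Type :=
  ((jet_label M -> jet_space M -> 'rV[R]_n) *
   (jet_label M -> jet_space M -> 'M[R]_n))%type.

(* The functions of the chart c live on its domain; we encode such functions as
   total ones vanishing elsewhere, so that equality is equality on the domains. *)
Definition supported (R : realType) (n : nat) (M : manifold R n)
    (N : coeffs M) : Prop :=
  forall c u, ~ cdom (jet_space M) c u -> N.1 c u = 0 /\ N.2 c u = 0.

(* The coordinate functions p_j of the chart d, as functions of the coordinates
   (t, x, p) of the chart c, differentiated in the direction e. *)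
Definition dP (R : realType) (n : nat) (M : manifold R n)
    (c d : jet_label M) (e : jet_model R n) (u : jet_space M) (j : 'I_n) : R :=
  ('D_e (on_chart (jet_chart c) (fun y => mom y d)) (jet_chart c u)) 0 j.

Definition transformation_rules (R : realType) (n : nat) (M : manifold R n)
    (N : coeffs M) : Prop :=
  forall (c d : jet_label M) (u : jet_space M),
    cdom (jet_space M) c u -> cdom (jet_space M) d u ->
    (forall j, N.1 d u 0 j =
       \sum_k N.1 c u 0 k * dX d c (base_pt u) k j
       - dT d c (base_pt u) * dP c d (dir_t R n) u j) /\
    (forall j r, N.2 d u j r =
       \sum_k \sum_i N.2 c u k i * dT c d (base_pt u)
          * dX d c (base_pt u) k j * dX d c (base_pt u) i r
       - \sum_i dX d c (base_pt u) i r * dP c d (dir_x R i) u j).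

Definition nonlinear_connection (R : realType) (n : nat) (M : manifold R n)
    (N : coeffs M) : Prop :=
  [/\ supported N,
      forall c, smooth_fun (cdom (jet_space M) c) (N.1 c) /\
                smooth_fun (cdom (jet_space M) c) (N.2 c) &
      transformation_rules N].

Definition coefficients_of (R : realType) (n : nat) (M : manifold R n)
    (H : jet_space M -> set (jet_tvec M)) (N : coeffs M) : Prop :=
  supported N /\
  forall c, exists dt dx, adapted_fields H c dt dx /\
                          expansion c dt dx (N.1 c) (N.2 c).

(* Main.v *)
Require Import Defs.
From HB Require Import structures.
From mathcomp Require Import all_boot all_order all_algebra.
From mathcomp Require Import all_classical all_reals all_analysis.
From mathcomp Require Import ring.
Set Implicit Arguments.
Unset Strict Implicit.
Unset Printing Implicit Defensive.
Import Order.TTheory GRing.Theory Num.Theory.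
Import numFieldNormedType.Exports.
Local Open Scope classical_set_scope.
Local Open Scope ring_scope.

(* A horizontal space projects isomorphically onto the tangent space of the
   base, so over a chart every horizontal vector is the unique horizontal lift
   of its base components: it is a graph [p = - N_1 a - N_2 b] over them. The
   lifts of a fixed base direction are combinations of a local frame of H whose
   coefficients come from the inverse of the matrix of base components of that
   frame; by Cramer's rule they are smooth. Comparing the graphs of the same
   space in two charts, through the differential of the change of coordinates,
   gives the transformation rules; read backwards, the rules say that the
   graphs of a nonlinear connection do not depend on the chart. *)

(** * Calculus of C^k maps *)

Section Differentials.
Context {R : realType}.
Implicit Types V W E : normedModType R.

(** What shapes the argument is the block triangular differential of a change of jet coordinates.
    New base components depend on old base components alone, so having base component 0 in one chart
    characterises vertical vectors. Over a fixed base point the new momenta are linear in the old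
    ones, so the vertical block is tensorial. The remaining block, the derivatives of the new
    momenta along the base, is exactly the inhomogeneous part of the rules. Two obstacles lie on the
    way. Coordinate expressions are extended by 0 outside the image of a chart, so identities
    between them hold only near a point, and differentials are compared through germs by
    [near_eq_diff]. And the jet space comes with charts but without a topology: openness of its
    overlaps and smoothness of its transition maps are derived from those of the line and of M.
    Calculus on the base is in turn read off from the jet space. *)

Lemma near_eq_diff V W (f g : V -> W) (x : V) :
  (\forall y \near x, f y = g y) -> differentiable f x ->
  differentiable g x /\ 'd g x = 'd f x :> (V -> W).
Proof.
move=> fg df; have fgx : f x = g x := nbhs_singleton fg.
have gE : g \o shift x = cst (g x) + 'd f x +o_ 0 id.
  apply/eqaddoP => _/posnumP[e].
  have /eqaddoP /(_ e%:num) /(_ [gt0 of e%:num]) := diff_locally df.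
  have shift0 : (fun y : V => y + x) @ 0 --> x.
    rewrite -[X in _ --> X]add0r.
    by apply: (@continuousD _ _ _ id (cst x)) => //; exact: cvg_cst.
  apply: filter_app; have := shift0 _ fg; rewrite /nbhs /= => fg0.
  near=> y.
  have -> : (g \o shift x - (cst (g x) + 'd f x : V -> W)) y =
     (f \o shift x - (cst (f x) + 'd f x : V -> W)) y.
    rewrite !fctE /= -fgx; congr (_ - _).
    by have /= -> := near fg0 y.
  by [].
have dgE : 'd g x = 'd f x :> (V -> W).
  by apply: diff_unique => //; exact: diff_continuous.
split=> //; apply/diff_locallyP; rewrite dgE; split => //.
exact: diff_continuous.
Unshelve. all: by end_near. Qed.

Lemma scaler_is_bilinear W :
  bilinear_for
    (GRing.Scale.Law.clone _ _ *:%R _) (GRing.Scale.Law.clone _ _ *:%R _)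
    (@GRing.scale R W).
Proof.
split=> [u'|u] a x y /=.
- by rewrite scalerDl scalerA.
- by rewrite scalerDr !scalerA mulrC.
Qed.

HB.instance Definition _ W :=
  bilinear_isBilinear.Build R R W W _ _ (@GRing.scale R W)
  (@scaler_is_bilinear W).

Lemma is_diff_scale V W (f df : V -> R) (g dg : V -> W) (x : V) :
  is_diff x f df -> is_diff x g dg ->
  is_diff x (fun y => f y *: g y) (fun v => f x *: dg v + df v *: g x).
Proof.
move=> dfx dgx.
have cs : continuous (fun p : R * W => p.1 *: p.2).
  by move=> p; exact: scale_continuous.
have ds (p : R * W) : is_diff p (fun p : R * W => p.1 *: p.2)
    (fun q => p.1 *: q.2 + q.1 *: p.2).
  apply: DiffDef.
    exact: (@differentiable_bilin _ _ _ _ (@GRing.scale R W) p cs).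
  exact: (@diff_bilin _ _ _ _ (@GRing.scale R W) p cs).
have -> : (fun y => f y *: g y) =
  (fun p : R * W => p.1 *: p.2) \o (fun y => (f y, g y)) by [].
by apply: is_diff_eq.
Qed.

End Differentials.

Section Ck_calculus.
Context {R : realType}.
Implicit Types V W E : normedModType R.

(** Openness of [U] upgrades pointwise agreement to agreement near each point, which is what
    derivatives see. *)
Lemma eq_Ck_on k V W (U : set V) (f g : V -> W) :
  open U -> (forall x, U x -> f x = g x) -> Ck_on k U f -> Ck_on k U g.
Proof.
move=> oU; elim: k f g => [|k IH] f g fg.
  move=> cf x Ux; rewrite /prop_for /continuous_at -(fg x Ux).
  apply: cvg_trans (cf x Ux); apply: near_eq_cvg.
  by apply: filterS (open_nbhs_nbhs (conj oU Ux)) => y /fg.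
move=> [df Cf]; have fgx x : U x -> \forall y \near x, f y = g y.
  by move=> Ux; apply: filterS (open_nbhs_nbhs (conj oU Ux)) => y /fg.
split=> [x Ux|v]; first by have [] := near_eq_diff (fgx x Ux) (df x Ux).
apply: IH (Cf v) => x Ux.
by have [_ ->] := near_eq_diff (fgx x Ux) (df x Ux).
Qed.

(** Lets an explicit formula replace the differential; the closure properties below are inductions
    on [k] whose step applies this to the matching differentiation rule. *)
Lemma Ck_onS k V W (U : set V) (f : V -> W) (df : V -> V -> W) :
  open U -> (forall x, U x -> is_diff x f (df x)) ->
  (forall v, Ck_on k U (df ^~ v)) -> Ck_on k.+1 U f.
Proof.
move=> oU fdf Cdf; split=> [x /fdf[]//|v].
by apply: eq_Ck_on (Cdf v) => // x /fdf[_ ->].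
Qed.

Lemma Ck_on_diff k V W (U : set V) (f : V -> W) (x : V) :
  Ck_on k.+1 U f -> U x -> is_diff x f ('d f x).
Proof. by move=> [df _] Ux; apply: DiffDef => //; exact: df. Qed.

Lemma Ck_on_d k V W (U : set V) (f : V -> W) (v : V) :
  Ck_on k.+1 U f -> Ck_on k U (fun x => 'd f x v).
Proof. by case=> _; apply. Qed.

Lemma Ck_onW k V W (U : set V) (f : V -> W) : Ck_on k.+1 U f -> Ck_on k U f.
Proof.
elim: k f => [|k IH] f [df Cf].
  by move=> x Ux; apply/differentiable_continuous/df.
by split=> // v; exact/IH/Cf.
Qed.

Lemma sub_Ck_on k V W (U U' : set V) (f : V -> W) :
  U' `<=` U -> Ck_on k U f -> Ck_on k U' f.
Proof.
move=> U'U; elim: k f => [|k IH] f; first by move=> cf x /U'U/cf.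
by move=> [df Cf]; split=> [x /U'U/df//|v]; exact/IH/Cf.
Qed.

(** Each clause of [Ck_on] concerns the germ of the map in [V] at single points, so any set around
    the point will do. It serves where only local frames exist. *)
Lemma Ck_on_local k V W (U : set V) (f : V -> W) :
  (forall x, U x -> exists2 U', U' x & Ck_on k U' f) -> Ck_on k U f.
Proof.
elim: k f => [|k IH] f h; first by move=> x /h[U' U'x]; apply.
split=> [x /h[U' U'x [df _]]|v]; first exact: df.
by apply: IH => x /h[U' U'x [_ Cf]]; exists U' => //; exact: Cf.
Qed.

Lemma Ck_on_cst k V W (U : set V) (w : W) : open U -> Ck_on k U (cst w).
Proof.
move=> oU; elim: k w => [|k IH] w; first by move=> x _; exact: cvg_cst.
apply: (@Ck_onS _ _ _ _ _ (fun=> 0)) => // v; exact: (IH 0).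
Qed.

Lemma Ck_on_linear k V W (U : set V) (l : {linear V -> W}) :
  open U -> continuous l -> Ck_on k U l.
Proof.
move=> oU cl; case: k => [|k]; first by move=> x _; exact: cl.
apply: (@Ck_onS _ _ _ _ _ (fun=> l)) => // [x _|v]; last exact: Ck_on_cst.
by apply: DiffDef; [exact: linear_differentiable|exact: diff_lin].
Qed.

Lemma Ck_on_comp_linear k V W E (U : set V) (l : {linear W -> E}) (f : V -> W) :
  open U -> continuous l -> Ck_on k U f -> Ck_on k U (fun x => l (f x)).
Proof.
move=> oU cl; elim: k f => [|k IH] f Cf.
  by move=> x Ux; apply: continuous_comp; [exact: Cf|exact: cl].
apply: (@Ck_onS _ _ _ _ _ (fun x v => l ('d f x v))) => // [x Ux|v].
  have dl : is_diff (f x) l l.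
    by apply: DiffDef; [exact: linear_differentiable|exact: diff_lin].
  have dfx := Ck_on_diff Cf Ux.
  exact: (is_diff_comp dfx dl).
by apply: IH; exact: Ck_on_d Cf.
Qed.

Lemma Ck_on_pair k V W E (U : set V) (f : V -> W) (g : V -> E) :
  open U -> Ck_on k U f -> Ck_on k U g -> Ck_on k U (fun x => (f x, g x)).
Proof.
move=> oU; elim: k f g => [|k IH] f g Cf Cg.
  by move=> x Ux; apply: cvg_pair; [exact: Cf|exact: Cg].
apply: (@Ck_onS _ _ _ _ _ (fun x v => ('d f x v, 'd g x v))) => // [x Ux|v].
  by have := Ck_on_diff Cf Ux; have := Ck_on_diff Cg Ux => ? ?; exact: is_diff_pair.
by apply: IH; [exact: Ck_on_d Cf|exact: Ck_on_d Cg].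
Qed.

Lemma Ck_onD k V W (U : set V) (f g : V -> W) :
  open U -> Ck_on k U f -> Ck_on k U g -> Ck_on k U (fun x => f x + g x).
Proof.
move=> oU; elim: k f g => [|k IH] f g Cf Cg.
  by move=> x Ux; apply: continuousD; [exact: Cf|exact: Cg].
apply: (@Ck_onS _ _ _ _ _ (fun x v => 'd f x v + 'd g x v)) => // [x Ux|v].
  by have := Ck_on_diff Cf Ux; have := Ck_on_diff Cg Ux => ? ?; exact: is_diffD.
by apply: IH; [exact: Ck_on_d Cf|exact: Ck_on_d Cg].
Qed.

Lemma Ck_on_sum k V W (U : set V) (I : Type) (r : seq I) (P : pred I)
    (f : I -> V -> W) :
  open U -> (forall i, P i -> Ck_on k U (f i)) ->
  Ck_on k U (fun x => \sum_(i <- r | P i) f i x).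
Proof.
move=> oU Cf; elim: r => [|i r IH].
  apply: (@eq_Ck_on _ _ _ _ (cst 0)) => // [x _|]; first by rewrite big_nil.
  exact: Ck_on_cst.
case Pi: (P i); last by apply: eq_Ck_on IH => // x _; rewrite big_cons Pi.
by apply: eq_Ck_on (Ck_onD oU (Cf i Pi) IH) => // x _; rewrite big_cons Pi.
Qed.

Lemma Ck_onZ k V W (U : set V) (f : V -> R) (g : V -> W) :
  open U -> Ck_on k U f -> Ck_on k U g -> Ck_on k U (fun x => f x *: g x).
Proof.
move=> oU; elim: k f g => [|k IH] f g Cf Cg.
  by move=> x Ux; apply: continuousZ; [exact: Cf|exact: Cg].
apply: (@Ck_onS _ _ _ _ _ (fun x v => f x *: 'd g x v + 'd f x v *: g x)) => //.
  move=> x Ux; have := Ck_on_diff Cf Ux; have := Ck_on_diff Cg Ux => ? ?.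
  exact: is_diff_scale.
move=> v; apply: Ck_onD => //; apply: IH; do ?exact: Ck_onW.
  exact: Ck_on_d Cg.
exact: Ck_on_d Cf.
Qed.

Lemma Ck_onM k V (U : set V) (f g : V -> R) :
  open U -> Ck_on k U f -> Ck_on k U g -> Ck_on k U (fun x => f x * g x).
Proof. by move=> oU Cf Cg; exact: (Ck_onZ oU Cf Cg). Qed.

Lemma Ck_on_prod k V (U : set V) (I : Type) (r : seq I) (P : pred I)
    (f : I -> V -> R) :
  open U -> (forall i, P i -> Ck_on k U (f i)) ->
  Ck_on k U (fun x => \prod_(i <- r | P i) f i x).
Proof.
move=> oU Cf; elim: r => [|i r IH].
  apply: (@eq_Ck_on _ _ _ _ (cst (1 : R))) => // [x _|]; first by rewrite big_nil.
  exact: Ck_on_cst.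
case Pi: (P i); last by apply: eq_Ck_on IH => // x _; rewrite big_cons Pi.
by apply: eq_Ck_on (Ck_onM oU (Cf i Pi) IH) => // x _; rewrite big_cons Pi.
Qed.

(** The derivative of the inverse is a product of inverses of [f] and ['d f x v], so the induction
    on [k] runs with [f] fixed. *)
Lemma Ck_on_inv k V (U : set V) (f : V -> R) :
  open U -> (forall x, U x -> f x != 0) -> Ck_on k U f ->
  Ck_on k U (fun x => (f x)^-1).
Proof.
move=> oU f0; elim: k => [|k IH] Cf.
  by move=> x Ux; apply: cvgV; [exact: f0|exact: Cf].
have Cf' := IH (Ck_onW Cf).
apply: (@Ck_onS _ _ _ _ _ (fun x v => (-1) * ((f x)^-1 * (f x)^-1) * 'd f x v)) => //.
  move=> x Ux; have [df _] := Ck_on_diff Cf Ux; apply: DiffDef.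
    exact: differentiableV (f0 x Ux).
  rewrite diffV ?f0//; apply/funext => v /=.
  by rewrite -expr2 exprVn mulN1r.
move=> v; apply: Ck_onM => //; last exact: Ck_on_d Cf.
by apply: Ck_onM => //; [exact: Ck_on_cst|exact: Ck_onM].
Qed.

(** Finite dimension, as vectors with continuous coefficient functionals: a form that passes to
    products and writes a differential as a finite sum over fixed directions. *)
Definition finite_frame (E : normedModType R) : Prop :=
  exists (I : finType) (e : I -> E) (phi : I -> {linear E -> R}),
    (forall i, continuous (phi i)) /\ forall y, y = \sum_i phi i y *: e i.

Lemma finite_frame_prod V W :
  finite_frame V -> finite_frame W -> finite_frame (V * W)%type.
Proof.
move=> [I [e [phi [cphi phiE]]]] [J [d [psi [cpsi psiE]]]].
exists (I + J)%type.
exists (fun k => match k with inl i => (e i, 0) | inr j => (0, d j) end).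
exists (fun k => match k with
  | inl i => phi i \o (@fst V W) : {linear (V * W)%type -> R}
  | inr j => psi j \o (@snd V W) : {linear (V * W)%type -> R} end).
split=> [[i|j] x /=|[y z]].
- by apply: continuous_comp; [exact: cvg_fst|exact: cphi].
- by apply: continuous_comp; [exact: cvg_snd|exact: cpsi].
rewrite big_sumType /=.
have sumE (K : finType) (F : K -> V) (G : K -> W) :
    \sum_i (F i, G i) = (\sum_i F i, \sum_i G i).
  by elim/big_rec3: _ => // i v w p _ ->.
rewrite (eq_bigr (fun i => (phi i y *: e i, 0))); last first.
  by move=> i _; congr pair; rewrite scaler0.
rewrite [X in _ + X](eq_bigr (fun j => (0, psi j z *: d j))); last first.
  by move=> j _; congr pair; rewrite scaler0.
rewrite !sumE !big1_eq -phiE -psiE.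
by apply: injective_projections; rewrite /= ?addr0 ?add0r.
Qed.

Lemma finite_frame_real : finite_frame R.
Proof.
exists unit, (fun=> 1), (fun=> idfun); split=> [_ x|y]; first exact: cvg_id.
by rewrite big_const card_unit /= addr0 [_ *: _]mulr1.
Qed.

Section Coordinate.
Context {m n : nat}.

Definition mx_coord (i : 'I_m) (j : 'I_n) (A : 'M[R]_(m, n)) : R := A i j.

Lemma mx_coord_is_linear i j : linear (mx_coord i j).
Proof. by move=> a A B; rewrite /mx_coord !mxE. Qed.

HB.instance Definition _ i j :=
  GRing.isLinear.Build R 'M[R]_(m, n) R _ (mx_coord i j) (mx_coord_is_linear i j).

Lemma continuous_mx_coord i j : continuous (mx_coord i j).
Proof. exact: coord_continuous. Qed.

End Coordinate.

Lemma finite_frame_mx m n : finite_frame 'M[R]_(m, n).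
Proof.
exists ('I_m * 'I_n)%type, (fun p => delta_mx p.1 p.2).
exists (fun p => mx_coord p.1 p.2); split=> [p|A].
  exact: continuous_mx_coord.
by rewrite {1}(matrix_sum_delta A) pair_bigA.
Qed.

(* [Ck_on] differentiates in fixed directions only, whereas the chain rule gives
   ['d g (f x)] in the direction ['d f x v]; the frame of E turns it into a sum
   over fixed directions. *)
Lemma Ck_on_comp k V E W (U : set V) (P : set E) (f : V -> E) (g : E -> W) :
  finite_frame E -> open U -> (forall x, U x -> P (f x)) ->
  Ck_on k U f -> Ck_on k P g -> Ck_on k U (fun x => g (f x)).
Proof.
move=> [I [e [phi [cphi phiE]]]] oU UP; elim: k W g => [|k IH] W g Cf Cg.
  by move=> x Ux; apply: continuous_comp; [exact: Cf|exact/Cg/UP].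
apply: (@Ck_onS _ _ _ _ _
    (fun x v => \sum_i phi i ('d f x v) *: 'd g (f x) (e i))) => // [x Ux|v].
  have dfx := Ck_on_diff Cf Ux; have dgx := Ck_on_diff Cg (UP x Ux).
  apply: (is_diff_eq (is_diff_comp dfx dgx)); apply/funext => v /=.
  by rewrite {1}(phiE ('d f x v)) linear_sum; apply: eq_bigr => i _; rewrite linearZ.
apply: Ck_on_sum => // i _; apply: Ck_onZ => //.
  by apply: Ck_on_comp_linear => //; exact: Ck_on_d Cf.
by apply: (IH _ (fun y => 'd g y (e i))); [exact: Ck_onW|exact: Ck_on_d Cg].
Qed.

Lemma Ck_on_coord k V m n (U : set V) (A : V -> 'M[R]_(m, n)) i j :
  open U -> Ck_on k U A -> Ck_on k U (fun x => A x i j).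
Proof.
by move=> oU CA; exact: (@Ck_on_comp_linear _ _ _ _ _ (mx_coord i j) _ oU
  (@continuous_mx_coord _ _ i j) CA).
Qed.

Lemma Ck_on_mx k V m n (U : set V) (A : V -> 'M[R]_(m, n)) :
  open U -> (forall i j, Ck_on k U (fun x => A x i j)) -> Ck_on k U A.
Proof.
move=> oU CA.
apply: (@eq_Ck_on _ _ _ _ (fun x => \sum_i \sum_j A x i j *: delta_mx i j)) => //.
  by move=> x _; rewrite -matrix_sum_delta.
do 2![apply: Ck_on_sum => // ? _].
by apply: Ck_onZ => //; exact: Ck_on_cst.
Qed.

Lemma Ck_on_det k V n (U : set V) (A : V -> 'M[R]_n) :
  open U -> (forall i j, Ck_on k U (fun x => A x i j)) ->
  Ck_on k U (fun x => \det (A x)).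
Proof.
(* The determinant unfolds to the Leibniz sum of signed products over permutations. *)
move=> oU CA; apply: Ck_on_sum => // s _; apply: Ck_onM => //.
  exact: Ck_on_cst.
by apply: Ck_on_prod.
Qed.

Lemma Ck_on_invmx k V n (U : set V) (A : V -> 'M[R]_n) :
  open U -> (forall x, U x -> A x \in unitmx) ->
  (forall i j, Ck_on k U (fun x => A x i j)) ->
  forall i j, Ck_on k U (fun x => invmx (A x) i j).
Proof.
move=> oU uA CA i j.
(* Entry [i j] of the adjugate is the cofactor at [j i], hence the swapped indices. *)
apply: (@eq_Ck_on _ _ _ _
  (fun x => (\det (A x))^-1 * ((-1) ^+ (j + i) * \det (row' j (col' i (A x)))))) => //.
  by move=> x Ux; rewrite /invmx (uA x Ux) !mxE.
apply: Ck_onM => //.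
  apply: Ck_on_inv => //; last exact: Ck_on_det.
  by move=> x Ux; have := uA x Ux; rewrite unitmxE unitfE.
apply: Ck_onM => //; first exact: Ck_on_cst.
apply: Ck_on_det => // i' j'.
by apply: eq_Ck_on (CA (lift j i') (lift i j')) => // x _; rewrite !mxE.
Qed.

End Ck_calculus.

Section Smooth_on.
Context {R : realType}.
Implicit Types V W E : normedModType R.

Lemma eq_smooth_on V W (U : set V) (f g : V -> W) :
  (forall x, U x -> f x = g x) -> smooth_on U f -> smooth_on U g.
Proof. by move=> fg [oU Cf]; split=> // k; exact: eq_Ck_on (Cf k). Qed.

Lemma smooth_on_comp V E W (U : set V) (P : set E) (f : V -> E) (g : E -> W) :
  finite_frame E -> (forall x, U x -> P (f x)) ->
  smooth_on U f -> smooth_on P g -> smooth_on U (fun x => g (f x)).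
Proof.
move=> fE UP [oU Cf] [_ Cg]; split=> // k.
exact: (Ck_on_comp fE oU UP (Cf k) (Cg k)).
Qed.

Lemma smooth_on_d V W (U : set V) (f : V -> W) (v : V) :
  smooth_on U f -> smooth_on U (fun x => 'd f x v).
Proof. by move=> [oU Cf]; split=> // k; exact: Ck_on_d (Cf k.+1). Qed.

Lemma smooth_on_differentiable V W (U : set V) (f : V -> W) (x : V) :
  smooth_on U f -> U x -> differentiable f x.
Proof. by move=> [_ Cf] Ux; case: (Cf 1%N) => df _; exact: df. Qed.

(** A vector field changes charts by an expression of this form, where base point and vector vary
    together. The frame separates them: scalar coefficients of [h x] times derivatives of [f] in
    fixed directions. *)
Lemma smooth_on_diff_apply V W E (U : set W) (P : set V) (f : V -> E)
    (g h : W -> V) :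
  finite_frame V -> (forall x, U x -> P (g x)) -> smooth_on P f ->
  smooth_on U g -> smooth_on U h -> smooth_on U (fun x => 'd f (g x) (h x)).
Proof.
move=> fV UP Cf Cg [oU Ch]; have [I [e [phi [cphi phiE]]]] := fV.
split=> // k.
apply: (@eq_Ck_on _ _ _ _ _
  (fun x => \sum_i phi i (h x) *: 'd f (g x) (e i))) => //.
  move=> x Ux; rewrite {2}(phiE (h x)) linear_sum.
  by apply: eq_bigr => i _; rewrite linearZ.
apply: Ck_on_sum => // i _; apply: Ck_onZ => //.
  exact: Ck_on_comp_linear.
have [_] := smooth_on_comp fV UP Cg (smooth_on_d (e i) Cf); exact.
Qed.

End Smooth_on.

Lemma on_chartE (R : realType) (V W : normedModType R) (X : Type)
    (c : chart V X) (f : X -> W) (u : X) :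
  set_inj (dom c) c -> dom c u -> on_chart c f (c u) = f u.
Proof.
move=> cinj cu; rewrite /on_chart; case: pselect => [e|[]]; last by exists u.
by case: (cid e) => v [cv cvu] /=; congr f; apply: cinj; rewrite ?inE.
Qed.

(** * Charts and tangent vectors *)

(** Isolates what the calculus of tangent vectors relies on, so that it serves the time line, M and
    the jet space alike. *)
Definition smooth_atlas (R : realType) (V : normedModType R) (X : charted V) :=
  (forall c, set_inj (cdom X c) (chart_of X c)) /\
  forall c d, smooth_on (chart_of X c @` (cdom X c `&` cdom X d))
                        (on_chart (chart_of X c) (chart_of X d)).

Section Charted.
Context {R : realType} {V : normedModType R} {X : charted V}.
Hypotheses (fV : finite_frame V) (aX : smooth_atlas X).
Implicit Types (c d e : label X) (u : X) (W : normedModType R).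

Local Notation trans c d := (on_chart (chart_of X c) (chart_of X d)).
Local Notation overlap c d := (chart_of X c @` (cdom X c `&` cdom X d)).

Lemma coord_inj c u v : cdom X c u -> cdom X c v ->
  chart_of X c u = chart_of X c v -> u = v.
Proof. by case: aX => h _ cu cv; apply: (h c); rewrite inE. Qed.

Lemma charted_onE c W (f : X -> W) u :
  cdom X c u -> on_chart (chart_of X c) f (chart_of X c u) = f u.
Proof. by case: aX => h _; exact: on_chartE. Qed.

Lemma smooth_trans c d : smooth_on (overlap c d) (trans c d).
Proof. by case: aX. Qed.

Lemma trans_differentiable c d u : cdom X c u -> cdom X d u ->
  differentiable (trans c d) (chart_of X c u).
Proof.
move=> cu du; apply: smooth_on_differentiable (smooth_trans c d) _.
by exists u.
Qed.

Lemma near_overlap c d u : cdom X c u -> cdom X d u ->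
  \forall z \near chart_of X c u, overlap c d z.
Proof.
move=> cu du; have [oO _] := smooth_trans c d.
by apply: open_nbhs_nbhs; split=> //; exists u.
Qed.

Lemma on_chart_trans c d W (f : X -> W) z : overlap c d z ->
  on_chart (chart_of X c) f z = on_chart (chart_of X d) f (trans c d z).
Proof. by move=> [u [cu du] <-]; rewrite !charted_onE. Qed.

Lemma trans_chain c d e u : cdom X c u -> cdom X d u -> cdom X e u ->
  forall v, 'd (trans c e) (chart_of X c u) v =
    'd (trans d e) (chart_of X d u) ('d (trans c d) (chart_of X c u) v).
Proof.
move=> cu du eu v.
have cE : \forall z \near chart_of X c u, trans c e z = (trans d e \o trans c d) z.
  by apply: filterS (near_overlap cu du) => z; exact: on_chart_trans.
have [_ <-] := near_eq_diff cE (trans_differentiable cu eu).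
have := @diff_comp _ _ _ _ (trans c d) (trans d e) (chart_of X c u).
rewrite charted_onE// => /(_ (trans_differentiable cu du)).
by move=> /(_ (trans_differentiable du eu)) ->.
Qed.

Lemma trans_refl c u : cdom X c u ->
  forall v, 'd (trans c c) (chart_of X c u) v = v.
Proof.
move=> cu v.
have cE : \forall z \near chart_of X c u, trans c c z = id z.
  apply: filterS (near_overlap cu cu) => z [y [cy _] <-].
  by rewrite charted_onE.
have [_ <-] := near_eq_diff cE (trans_differentiable cu cu).
by rewrite diff_val.
Qed.

Lemma tangent0 u : tangent u (0 : tvec X V).
Proof. by split=> // c d _ _; rewrite linear0. Qed.

Lemma tangent_comb u (a : R) (v w : tvec X V) :
  tangent u v -> tangent u w -> tangent u (a *: v + w).
Proof.
move=> [v0 vT] [w0 wT]; split=> [c cu|c d cu du].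
  by rewrite !fctE v0// w0// scaler0 addr0.
by rewrite !fctE (vT c d)// (wT c d)// linearP.
Qed.

(** The transition rule propagates one component to all charts at [u], and the other entries are 0.
    Equalities of vectors thereby reduce to a single chart. *)
Lemma tangent_eq c u (v w : tvec X V) :
  cdom X c u -> tangent u v -> tangent u w -> v c = w c -> v = w.
Proof.
move=> cu [v0 vT] [w0 wT] vw; apply/funext => d.
have [du|du] := pselect (cdom X d u); last by rewrite v0 ?w0.
by rewrite (vT c d)// (wT c d)// vw.
Qed.

Lemma coord_vecE c d (b : V) u : cdom X c u -> cdom X d u ->
  coord_vec c b u d = 'd (trans c d) (chart_of X c u) b.
Proof. by move=> cu du; rewrite /coord_vec; case: asboolP => // -[]. Qed.

Lemma coord_vec_id c (b : V) u : cdom X c u -> coord_vec c b u c = b.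
Proof. by move=> cu; rewrite coord_vecE// trans_refl. Qed.

Lemma tangent_coord_vec c (b : V) u : cdom X c u -> tangent u (coord_vec c b u).
Proof.
move=> cu; split=> [d du|d d' du d'u].
  by rewrite /coord_vec; case: asboolP => // -[].
by rewrite !coord_vecE//; exact: trans_chain.
Qed.

(** [X] has no topology: open means having open images in all charts, and continuity of the
    transition maps carries this over from the chart [c]. *)
Lemma open_image_chart c d (U : set X) : U `<=` cdom X c ->
  open (chart_of X c @` U) -> open (chart_of X d @` (U `&` cdom X d)).
Proof.
move=> Uc oU; rewrite openE => _ [u [Uu du] <-].
have cu := Uc u Uu; rewrite /interior.
have cont : {for chart_of X d u, continuous (trans d c)}.
  exact/differentiable_continuous/trans_differentiable.
have nU : \forall z \near chart_of X d u, (chart_of X c @` U) (trans d c z).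
  by apply: cont; rewrite charted_onE//; apply: open_nbhs_nbhs; split=> //; exists u.
apply: filterS2 (near_overlap du cu) nU => z [y [dy cy] <-].
rewrite charted_onE// => -[y' Uy' yy']; exists y => //; split=> //.
by rewrite -(coord_inj (Uc _ Uy') cy yy').
Qed.

Lemma smooth_trans_in c d (U : set X) : U `<=` cdom X c ->
  open (chart_of X c @` U) ->
  smooth_on (chart_of X d @` (U `&` cdom X d)) (trans d c).
Proof.
move=> Uc oU; have [_ Cdc] := smooth_trans d c.
split=> [|k]; first exact: open_image_chart Uc oU.
by apply: sub_Ck_on (Cdc k) => _ [u [Uu du] <-]; exists u => //; split=> //; exact: Uc.
Qed.

Lemma smooth_fun_in_chart c (U : set X) W (f : X -> W) : U `<=` cdom X c ->
  smooth_on (chart_of X c @` U) (on_chart (chart_of X c) f) -> smooth_fun U f.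
Proof.
move=> Uc Cf d; have [oU _] := Cf.
apply: (@eq_smooth_on _ _ _ _
  (fun z => on_chart (chart_of X c) f (trans d c z))).
  by move=> _ [u [Uu du] <-]; rewrite -on_chart_trans//; exists u => //; split=> //; exact: Uc.
apply: (smooth_on_comp fV _ (smooth_trans_in d Uc oU) Cf).
by move=> _ [u [Uu du] <-]; exists u => //; rewrite charted_onE.
Qed.

(** Smoothness is demanded in every chart [d]; there the component is the differential of the
    transition applied to the component in [c]. *)
Lemma smooth_field_in_chart c (U : set X) (Y : X -> tvec X V) :
  U `<=` cdom X c -> (forall u, U u -> tangent u (Y u)) ->
  smooth_on (chart_of X c @` U) (on_chart (chart_of X c) (fun u => Y u c)) ->
  smooth_field U Y.
Proof.
move=> Uc TY CY; split=> // d; have [oU _] := CY.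
apply: (@eq_smooth_on _ _ _ _ (fun z => 'd (trans c d) (trans d c z)
   (on_chart (chart_of X c) (fun u => Y u c) (trans d c z)))).
  move=> _ [u [Uu du] <-]; have cu := Uc u Uu.
  by rewrite !charted_onE//; have [_ /(_ c d cu du)] := TY u Uu.
apply: (smooth_on_diff_apply fV (P := overlap c d)).
- by move=> _ [u [Uu du] <-]; exists u; [split=> //; exact: Uc|rewrite charted_onE].
- exact: smooth_trans.
- exact: smooth_trans_in.
- apply: (smooth_on_comp fV _ (smooth_trans_in d Uc oU) CY).
  by move=> _ [u [Uu du] <-]; exists u => //; rewrite charted_onE.
Qed.

End Charted.

(** * The dual jet space *)

Section Factors.
Context {R : realType} {n : nat} {M : manifold R n}.
Implicit Types (c d e : jet_label M) (q : R * M).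

Definition time_space : charted R :=
  @Charted R R R {c : chart R R | time_chart c} (@sval _ _).

Definition position_space : charted 'rV[R]_n :=
  @Charted R _ M {c | @atlas R n M c} (@sval _ _).

(** By definition a time chart is compatible with the identity chart only, so a transition between
    two of them is factored through the line itself. *)
Lemma time_atlas : smooth_atlas time_space.
Proof.
split=> [[c [[] ]]//|[c [tc [cid idc]]] [d [td [did idd]]] /=].
have [oc cinj _ cO] := tc; have [od _ _ _] := td.
have [_ Cidc] := idc; have [_ Cdid] := did.
have op : open (c @` (dom c `&` dom d)).
  by apply: cO; [exact: openI|move=> x []].
apply: (@eq_smooth_on _ _ _ _ (fun z => on_chart (Chart setT (fun t : R => t)) d
   (on_chart c (fun t : R => t) z))).
  move=> _ [t [ct dt] <-]; rewrite !(on_chartE _ cinj ct).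
  by rewrite (@on_chartE _ _ _ _ (Chart setT (fun t : R => t)) d t).
apply: (@smooth_on_comp _ _ _ _ _
    [set t | dom d t] (on_chart c (fun t : R => t))).
- exact: finite_frame_real.
- by move=> _ [t [ct dt] <-]; rewrite (on_chartE _ cinj ct).
- split=> // k; apply: sub_Ck_on (Cidc k) => _ [t [ct dt] <-].
  by exists t.
- split=> // k; apply: sub_Ck_on (Cdid k) => t dt.
  by exists t.
Qed.

Lemma position_atlas : smooth_atlas position_space.
Proof.
split=> [[c ac] /=|[c ac] [d ad] /=]; first by have [] := atlas_topological ac.
by have [] := atlas_compatible ac ad.
Qed.

Lemma dT_diff c d q (a : R) :
  dom (time_of c) q.1 -> dom (time_of d) q.1 ->
  'd (on_chart (time_of c) (time_of d)) (time_of c q.1) a = dT c d q * a.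
Proof.
move=> cq dq; rewrite diff1E.
  by rewrite /dT mulrC.
exact: (@trans_differentiable _ _ _ time_atlas c.1 d.1).
Qed.

Lemma dT_chain c d e q :
  dom (time_of c) q.1 -> dom (time_of d) q.1 -> dom (time_of e) q.1 ->
  dT c e q = dT d e q * dT c d q.
Proof.
move=> cq dq eq; 
rewrite -[LHS]mulr1 -(dT_diff 1 cq eq).
apply: etrans (@trans_chain _ _ _ time_atlas c.1 d.1 e.1 q.1 cq dq eq 1) _.
apply: etrans (dT_diff _ dq eq) _; congr (_ * _).
by apply: etrans (dT_diff _ cq dq) _; rewrite mulr1.
Qed.

Lemma dT_refl c q : dom (time_of c) q.1 -> dT c c q = 1.
Proof.
move=> cq; 
have : 'd (on_chart (time_of c) (time_of c)) (time_of c q.1) 1 = 1 :=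
  @trans_refl _ _ _ time_atlas c.1 q.1 cq 1.
by rewrite (dT_diff _ cq cq) mulr1.
Qed.

Lemma dX_diff c d q (b : 'rV[R]_n) (i : 'I_n) :
  dom (space_of c) q.2 -> dom (space_of d) q.2 ->
  'd (on_chart (space_of c) (space_of d)) (space_of c q.2) b 0 i =
  \sum_j dX c d q i j * b 0 j.
Proof.
move=> cq dq; rewrite {1}(row_sum_delta b) linear_sum summxE.
apply: eq_bigr => j _; rewrite linearZ mxE mulrC /dX deriveE//.
exact: (@trans_differentiable _ _ _ position_atlas c.2 d.2).
Qed.

Lemma dX_delta c d q i j :
  dom (space_of c) q.2 -> dom (space_of d) q.2 ->
  dX c d q i j =
  'd (on_chart (space_of c) (space_of d)) (space_of c q.2) (delta_mx 0 j) 0 i.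
Proof.
move=> cq dq; rewrite /dX deriveE//.
exact: (@trans_differentiable _ _ _ position_atlas c.2 d.2).
Qed.

Lemma dX_chain c d e q i j :
  dom (space_of c) q.2 -> dom (space_of d) q.2 -> dom (space_of e) q.2 ->
  dX c e q i j = \sum_k dX d e q i k * dX c d q k j.
Proof.
move=> cq dq eq; rewrite dX_delta//.

have -> : 'd (on_chart (space_of c) (space_of e)) (space_of c q.2) (delta_mx 0 j) =
    'd (on_chart (space_of d) (space_of e)) (space_of d q.2)
      ('d (on_chart (space_of c) (space_of d)) (space_of c q.2) (delta_mx 0 j)) :=
  @trans_chain _ _ _ position_atlas c.2 d.2 e.2 q.2 cq dq eq _.
rewrite (dX_diff _ _ dq eq); apply: eq_bigr => k _.
by rewrite (dX_delta _ _ cq dq).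
Qed.

Lemma dX_refl c q i j : dom (space_of c) q.2 -> dX c c q i j = (i == j)%:R.
Proof.
move=> cq; rewrite dX_delta//.
have -> : 'd (on_chart (space_of c) (space_of c)) (space_of c q.2) (delta_mx 0 j) =
    delta_mx 0 j :=
  @trans_refl _ _ _ position_atlas c.2 q.2 cq _.
by rewrite mxE eqxx eq_sym.
Qed.

End Factors.

(** * Points of the dual jet space and the formula for changing their coordinates *)

Section Jet.
Context {R : realType} {n : nat} {M : manifold R n}.
Implicit Types (c d e : jet_label M) (q : R * M) (u v : jet_space M).
Local Notation jet := (jet_space M).
Local Notation trans c d := (on_chart (jet_chart c) (jet_chart d)).
Local Notation overlap c d := (jet_chart c @` (cdom jet c `&` cdom jet d)).

Lemma eq_dual_jet (u v : dual_jet M) :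
  base_pt u = base_pt v -> mom u = mom v -> u = v.
Proof.
case: u v => [q p p0 pE] [q' p' p'0 p'E] /= qq' pp'; subst q' p'.
by congr DualJet; exact: Prop_irrelevance.
Qed.

Section At.
Variables (c : jet_label M) (q : R * M) (p : 'rV[R]_n).
Hypothesis cq : dom (base_chart c) q.

(** Prescribes [p] in the chart [c] and transports it to all other charts. The resulting point
    [jet_at] inverts the jet chart: every momentum occurs over a base point of its domain. *)
Definition jet_at_mom d : 'rV[R]_n :=
  if `[< dom (base_chart d) q >]
  then \row_i \sum_(j < n) dX d c q j i * dT c d q * p 0 j else 0.

Lemma jet_at_off d : ~ dom (base_chart d) q -> jet_at_mom d = 0.
Proof. by move=> dq; rewrite /jet_at_mom; case: asboolP. Qed.

(** The components transported from [c] are consistent by the chain rule for both Jacobians, which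
    run in opposite directions: [dX] from new to old, [dT] from old to new. *)
Lemma jet_at_change d e :
  dom (base_chart d) q -> dom (base_chart e) q ->
  forall i, jet_at_mom e 0 i =
    \sum_(j < n) dX e d q j i * dT d e q * jet_at_mom d 0 j.
Proof.
move=> dq eq i; rewrite /jet_at_mom.
case: asboolP => // _; case: asboolP => // _.
have [cq1 cq2] := cq; have [dq1 dq2] := dq; have [eq1 eq2] := eq.
transitivity (\sum_(k < n) \sum_(j < n)
    dX e d q j i * dT d e q * (dX d c q k j * dT c d q * p 0 k)).
  rewrite mxE; apply: eq_bigr => k _.
  rewrite (dX_chain _ _ eq2 dq2 cq2) (dT_chain cq1 dq1 eq1) !mulr_suml.
  by apply: eq_bigr => j _; ring.
rewrite exchange_big /=; apply: eq_bigr => j _.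
by rewrite mxE mulr_sumr.
Qed.

Definition jet_at : dual_jet M := DualJet jet_at_off jet_at_change.

Lemma jet_atE : jet_chart c jet_at = (time_of c q.1, space_of c q.2, p).
Proof.
rewrite /=; congr pair; rewrite /jet_at_mom; case: asboolP => // _.
have [cq1 cq2] := cq; apply/rowP => i; rewrite mxE (bigD1 i)//= big1 ?addr0.
  by rewrite (dX_refl _ _ cq2) eqxx dT_refl// !mul1r.
by move=> j ji; rewrite (dX_refl _ _ cq2) (negPf ji) !mul0r.
Qed.

End At.

Lemma jet_model_frame : finite_frame (jet_model R n).
Proof.
apply: finite_frame_prod; last exact: finite_frame_mx.
by apply: finite_frame_prod; [exact: finite_frame_real|exact: finite_frame_mx].
Qed.

Lemma jet_inj c : set_inj (cdom jet c) (chart_of jet c).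
Proof.
move=> u v; rewrite !inE /= => -[cu1 cu2] [cv1 cv2] [tE xE pE].
have quv : base_pt u = base_pt v.
  apply: injective_projections.
    exact: (@coord_inj _ _ _ time_atlas c.1).
  exact: (@coord_inj _ _ _ position_atlas c.2).
apply: eq_dual_jet => //; apply/funext => d.
have [du|du] := pselect (dom (base_chart d) (base_pt u)); last first.
  by rewrite (mom_off du) mom_off// -quv.
apply/rowP => i; rewrite (@mom_change _ _ _ u c d)//.
by rewrite (@mom_change _ _ _ v c d) -?quv// pE.
Qed.

(** The overlap is a cylinder, free in the momentum because [jet_at] realises every [p]. Its
    openness is thus inherited from the line and M. *)
Lemma overlapE c d : overlap c d =
  [set z | (time_of c @` (dom (time_of c) `&` dom (time_of d))) z.1.1 /\
           (space_of c @` (dom (space_of c) `&` dom (space_of d))) z.1.2].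
Proof.
apply/seteqP; split=> [_ [u [[cu1 cu2] [du1 du2]] <-]|[[t x] p]] /=.
  by split; [exists (base_pt u).1|exists (base_pt u).2].
move=> [[s [cs ds] <-{t}] [y [cy dy] <-{x}]].
have cq : dom (base_chart c) (s, y) by [].
by exists (jet_at p cq) => //; exact: jet_atE.
Qed.

Lemma continuous_time_comp : continuous (fun z : jet_model R n => z.1.1).
Proof. by move=> z; apply: continuous_comp; exact: cvg_fst. Qed.

Lemma continuous_space_comp : continuous (fun z : jet_model R n => z.1.2).
Proof. by move=> z; apply: continuous_comp; [exact: cvg_fst|exact: cvg_snd]. Qed.

Lemma open_overlap c d : open (overlap c d).
Proof.
rewrite overlapE; apply: openI.
  apply: (open_comp (f := fun z : jet_model R n => z.1.1)).
    by move=> z _; exact: continuous_time_comp.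
  by have [] := (@smooth_trans _ _ _ time_atlas c.1 d.1).
apply: (open_comp (f := fun z : jet_model R n => z.1.2)).
  by move=> z _; exact: continuous_space_comp.
by have [] := (@smooth_trans _ _ _ position_atlas c.2 d.2).
Qed.

(** The classical change of coordinates as a formula on the model space; the Jacobian of the inverse
    space change is evaluated at the new position. *)
Definition jet_trans c d (z : jet_model R n) : jet_model R n :=
  (on_chart (time_of c) (time_of d) z.1.1,
   on_chart (space_of c) (space_of d) z.1.2,
   \row_i \sum_(j < n)
     'D_(delta_mx 0 i) (on_chart (space_of d) (space_of c))
        (on_chart (space_of c) (space_of d) z.1.2) 0 j *
     derive1 (on_chart (time_of c) (time_of d)) z.1.1 * z.2 0 j).

Lemma jet_transE c d z : overlap c d z -> trans c d z = jet_trans c d z.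
Proof.
move=> [u [cu du] <-]; rewrite (on_chartE _ (@jet_inj c) cu) /= /jet_trans.
have [cu1 cu2] := cu; have [du1 du2] := du.
rewrite (@charted_onE _ _ _ time_atlas c.1 _ _ _ cu1).
rewrite (@charted_onE _ _ _ position_atlas c.2 _ _ _ cu2).
by congr pair; apply/rowP => i; rewrite mxE (@mom_change _ _ _ u c d).
Qed.

End Jet.

(** * Smoothness and differential of a change of jet coordinates *)

Section Jet.
Context {R : realType} {n : nat} {M : manifold R n}.
Implicit Types (c d e : jet_label M) (q : R * M) (u v : jet_space M).
Local Notation jet := (jet_space M).
Local Notation trans c d := (on_chart (jet_chart c) (jet_chart d)).
Local Notation overlap c d := (jet_chart c @` (cdom jet c `&` cdom jet d)).

Lemma Ck_jet_trans k c d : Ck_on k (overlap c d) (jet_trans c d).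
Proof.
have oO : open (overlap c d) by exact: open_overlap.
have tC : Ck_on k (overlap c d) (fun z : jet_model R n => z.1.1).
  exact: (Ck_on_linear k (l := @fst _ _ \o @fst _ _) oO continuous_time_comp).
have xC : Ck_on k (overlap c d) (fun z : jet_model R n => z.1.2).
  exact: (Ck_on_linear k (l := @snd _ _ \o @fst _ _) oO continuous_space_comp).
have pC j : Ck_on k (overlap c d) (fun z : jet_model R n => z.2 0 j).
  apply: Ck_on_coord => //.
  exact: (Ck_on_linear k (l := @snd _ _) oO (fun z => cvg_snd)).
have [oT CT] := @smooth_trans _ _ _ time_atlas c.1 d.1.
have [oX CX] := @smooth_trans _ _ _ position_atlas c.2 d.2.
have [oX' CX'] := @smooth_trans _ _ _ position_atlas d.2 c.2.
have inT z : overlap c d z ->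
    (time_of c @` (dom (time_of c) `&` dom (time_of d))) z.1.1.
  by rewrite overlapE => -[].
have inX z : overlap c d z ->
    (space_of c @` (dom (space_of c) `&` dom (space_of d))) z.1.2.
  by rewrite overlapE => -[].
have xiC : Ck_on k (overlap c d)
    (fun z => on_chart (space_of c) (space_of d) z.1.2).
  exact: (Ck_on_comp (finite_frame_mx _ _) oO inX xC (CX k)).
apply: Ck_on_pair => //; first apply: Ck_on_pair => //.
  exact: (Ck_on_comp finite_frame_real oO inT tC (CT k)).
apply: Ck_on_mx => // i0 i.
(* Partial derivatives become differentials in fixed directions; these are C^k because the
   transitions of the line and of M are C^(k+1). *)
apply: (@eq_Ck_on _ k (jet_model R n) R (overlap c d) (fun z => \sum_(j < n)
  'd (on_chart (space_of d) (space_of c))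
     (on_chart (space_of c) (space_of d) z.1.2) (delta_mx 0 i) 0 j *
  'd (on_chart (time_of c) (time_of d)) (z.1.1) 1 * z.2 0 j)) => //.
  move=> _ [u [[cu1 cu2] [du1 du2]] <-]; rewrite mxE; apply: eq_bigr => j _.
  congr (_ * _ * _).
    rewrite deriveE// /= (@charted_onE _ _ _ position_atlas c.2 _ _ _ cu2).
    exact: (@trans_differentiable _ _ _ position_atlas d.2 c.2).
  rewrite derive1E'//.
  exact: (@trans_differentiable _ _ _ time_atlas c.1 d.1).
apply: Ck_on_sum => // j _; apply: Ck_onM => //; apply: Ck_onM => //.
  apply: Ck_on_coord => //.
  apply: (Ck_on_comp (finite_frame_mx _ _) oO _ xiC
    (Ck_on_d (delta_mx 0 i) (CX' k.+1))).
  move=> z /inX[y [cy dy] <-]; exists y => //.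
  by rewrite (@charted_onE _ _ _ position_atlas c.2).
apply: (Ck_on_comp finite_frame_real oO inT tC
  (g := fun t : R => 'd (on_chart (time_of c) (time_of d)) t 1)).
exact: (Ck_on_d (1 : R) (CT k.+1)).
Qed.

Lemma jet_atlas : smooth_atlas jet.
Proof.
split=> [|c d]; first exact: jet_inj.
split=> [|k]; first exact: open_overlap.
apply: (@eq_Ck_on _ _ _ _ _ (jet_trans c d)).
- exact: open_overlap.
- by move=> z Oz; rewrite [RHS]jet_transE.
- exact: Ck_jet_trans.
Qed.

Lemma diff_comp_linear (V W E : normedModType R) (l : {linear W -> E})
    (f : V -> W) (x v : V) : continuous l -> differentiable f x ->
  'd (fun y => l (f y)) x v = l ('d f x v).
Proof.
move=> cl df; have dl : differentiable l (f x) by exact: linear_differentiable.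
by rewrite (diff_comp df dl) /= diff_lin.
Qed.

(** Near the point the change of jet coordinates commutes with the projection to time; both
    composites are differentiated. The space block below is treated alike. *)
Lemma trans_time_diff c d u (w : jet_model R n) : cdom jet c u -> cdom jet d u ->
  ('d (trans c d) (jet_chart c u) w).1.1 = dT c d (base_pt u) * w.1.1.
Proof.
move=> cu du; have [cu1 cu2] := cu; have [du1 du2] := du.
have dF : differentiable (trans c d) (jet_chart c u).
  exact: (@trans_differentiable _ _ _ jet_atlas).
rewrite -[LHS](@diff_comp_linear _ _ _ (@fst _ _ \o @fst _ _))//; last first.
  exact: continuous_time_comp.
have E : \forall z \near jet_chart c u, ((fst \o fst) \o trans c d) z =
    (on_chart (time_of c) (time_of d) \o (fst \o fst)) z.
  apply: filterS (near_overlap jet_atlas cu du) => z Oz.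
  by rewrite /= jet_transE.
have dl : differentiable (fst \o fst : jet_model R n -> R) (jet_chart c u).
  exact: (@linear_differentiable _ _ _ (@fst _ _ \o @fst _ _) _ continuous_time_comp).
have dt : differentiable (on_chart (time_of c) (time_of d)) (time_of c (base_pt u).1).
  exact: (@trans_differentiable _ _ _ time_atlas c.1 d.1).
have [_ <-] := near_eq_diff E (differentiable_comp dF
   (@linear_differentiable _ _ _ (@fst _ _ \o @fst _ _) _ continuous_time_comp)).
rewrite (diff_comp dl dt) /=.
rewrite (dT_diff _ cu1 du1); congr (_ * _).
by rewrite (@diff_lin _ _ _ (@fst _ _ \o @fst _ _) _ continuous_time_comp).
Qed.

Lemma trans_space_diff c d u (w : jet_model R n) i :
  cdom jet c u -> cdom jet d u ->
  ('d (trans c d) (jet_chart c u) w).1.2 0 i =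
  \sum_j dX c d (base_pt u) i j * w.1.2 0 j.
Proof.
move=> cu du; have [cu1 cu2] := cu; have [du1 du2] := du.
have dF : differentiable (trans c d) (jet_chart c u).
  exact: (@trans_differentiable _ _ _ jet_atlas).
have -> : ('d (trans c d) (jet_chart c u) w).1.2 =
    'd ((snd \o fst) \o trans c d) (jet_chart c u) w.
  rewrite -[LHS](@diff_comp_linear _ _ _ (@snd _ _ \o @fst _ _))//.
  exact: continuous_space_comp.
have E : \forall z \near jet_chart c u, ((snd \o fst) \o trans c d) z =
    (on_chart (space_of c) (space_of d) \o (snd \o fst)) z.
  apply: filterS (near_overlap jet_atlas cu du) => z Oz.
  by rewrite /= jet_transE.
have dl : differentiable (snd \o fst : jet_model R n -> _) (jet_chart c u).
  exact: (@linear_differentiable _ _ _ (@snd _ _ \o @fst _ _) _ continuous_space_comp).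
have dt : differentiable (on_chart (space_of c) (space_of d)) (space_of c (base_pt u).2).
  exact: (@trans_differentiable _ _ _ position_atlas c.2 d.2).
have [_ <-] := near_eq_diff E (differentiable_comp dF
   (@linear_differentiable _ _ _ (@snd _ _ \o @fst _ _) _ continuous_space_comp)).
rewrite (diff_comp dl dt) /=.
rewrite (dX_diff _ _ cu2 du2).
by rewrite (@diff_lin _ _ _ (@snd _ _ \o @fst _ _) _ continuous_space_comp).
Qed.

(** Identifies the derivatives of the new momenta occurring in the rules with the momentum part of
    the differential of the transition map. *)
Lemma dP_diff c d (w : jet_model R n) u j : cdom jet c u -> cdom jet d u ->
  dP c d w u j = ('d (trans c d) (jet_chart c u) w).2 0 j.
Proof.
move=> cu du.
have dF : differentiable (trans c d) (jet_chart c u).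
  exact: (@trans_differentiable _ _ _ jet_atlas).
have E : \forall z \near jet_chart c u, (snd \o trans c d) z =
    on_chart (jet_chart c) (fun y => mom y d) z.
  apply: filterS (near_overlap jet_atlas cu du) => z [y [cy dy] <-].
  by rewrite /= !(on_chartE _ (@jet_inj _ _ _ c) cy).
have dsF : differentiable (snd \o trans c d) (jet_chart c u).
  exact: (differentiable_comp dF
    (@linear_differentiable _ _ _ (@snd _ _) _ (fun z => cvg_snd))).
have DE := near_eq_derive w E; rewrite (deriveE w dsF) in DE.
apply: etrans (congr1 (fun p : 'rV_n => p 0 j) (esym DE)) _.
apply: (congr1 (fun p : 'rV_n => p 0 j)).
exact: (@diff_comp_linear _ _ _ (@snd _ _) _ _ _ (fun z => cvg_snd) dF).
Qed.

(** Along a vertical line the base coordinates stay put and the new momenta are affine, so the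
    difference quotient is constant and no Jacobian gets differentiated. *)
Lemma trans_vertical_diff c d u (p : 'rV[R]_n) : cdom jet c u -> cdom jet d u ->
  'd (trans c d) (jet_chart c u) (0, 0, p) =
  (0, 0, \row_i \sum_j dX d c (base_pt u) j i * dT c d (base_pt u) * p 0 j).
Proof.
move=> cu du.
have dF : differentiable (trans c d) (jet_chart c u).
  exact: (@trans_differentiable _ _ _ jet_atlas).
rewrite -deriveE// /derive; apply: lim_near_cst => //.
(* The whole vertical line lies in the overlap, a cylinder over the base; [jet_trans] therefore
   applies for every [h]. *)
have cO h : overlap c d (h *: ((0, 0, p) : jet_model R n) + jet_chart c u).
  have : overlap c d (jet_chart c u) by exists u.
  by rewrite !overlapE /= !scaler0 !add0r.
near=> h; have h0 : h != 0 by near: h; exact: nbhs_dnbhs_neq.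
have [[cu1 cu2] [du1 du2]] := (cu, du).
rewrite -[(_ \o _) _]/(trans c d (h *: ((0, 0, p) : jet_model R n) + jet_chart c u)).
rewrite (jet_transE (cO h)) jet_transE; last by exists u.
rewrite /jet_trans /= !scaler0 !add0r.
rewrite (@charted_onE _ _ _ position_atlas c.2 _ _ _ cu2).
apply: injective_projections; rewrite /=.
  by apply: injective_projections; rewrite /= subrr ?mulr0 ?scaler0.
apply/rowP => i; rewrite !mxE -sumrB mulr_sumr; apply: eq_bigr => j _.
rewrite !mxE /dX /dT -mulrBr addrK mulrCA; congr (_ * _).
by rewrite mulKf.
Unshelve. all: by end_near. Qed.

Lemma jet_model_decomp (w : jet_model R n) :
  w = w.1.1 *: dir_t R n + \sum_i w.1.2 0 i *: dir_x R i + (0, 0, w.2).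
Proof.
case: w => [[a b] p] /=.
have -> : \sum_i b 0 i *: dir_x R i = (0, b, 0).
  transitivity (\sum_i ((0, b 0 i *: delta_mx 0 i, 0) : jet_model R n)).
    apply: eq_bigr => i _; apply: injective_projections;
      [apply: injective_projections|]; by rewrite /= ?scaler0.
  rewrite [in RHS](row_sum_delta b).
  by elim/big_rec2: _ => // i x y _ ->; apply: injective_projections;
    [apply: injective_projections|]; rewrite /= ?addr0.
apply: injective_projections; [apply: injective_projections|];
  rewrite /= ?scaler0 ?addr0 ?add0r//.
by rewrite [RHS]mulr1.
Qed.

(** The total differential of the new momenta. The [dP] terms are the departure from a tensor law
    that makes the rules inhomogeneous. *)
Lemma trans_mom_diff c d u (w : jet_model R n) j :
  cdom jet c u -> cdom jet d u ->
  ('d (trans c d) (jet_chart c u) w).2 0 j =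
  w.1.1 * dP c d (dir_t R n) u j + \sum_i w.1.2 0 i * dP c d (dir_x R i) u j +
  \sum_k dX d c (base_pt u) k j * dT c d (base_pt u) * w.2 0 k.
Proof.
move=> cu du; pose L := 'd (trans c d) (jet_chart c u).
have -> : L w = w.1.1 *: L (dir_t R n) + \sum_i w.1.2 0 i *: L (dir_x R i) +
    L (0, 0, w.2).
  rewrite {1}(jet_model_decomp w) 2!linearD linear_sum linearZ /=.
  by congr (_ + _ + _); apply: eq_bigr => i _; rewrite linearZ.
rewrite /L trans_vertical_diff//= !mxE (dP_diff _ _ cu du); congr (_ + _ + _).
rewrite (raddf_sum snd) summxE; apply: eq_bigr => i _.
by rewrite /= !mxE (dP_diff _ _ cu du).
Qed.

End Jet.

(** * The projection to the base and vertical vectors *)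

Section Projection.
Context {R : realType} {n : nat} {M : manifold R n}.
Implicit Types (c d e : jet_label M) (q : R * M) (u v : jet_space M).
Local Notation jet := (jet_space M).
Local Notation base := (base_space M).
Local Notation trans c d := (on_chart (jet_chart c) (jet_chart d)).
Local Notation overlap c d := (jet_chart c @` (cdom jet c `&` cdom jet d)).

(** The atlas of M covers the position, and the identity of the line, shown to be a time chart,
    covers the time. *)
Lemma jet_cover u : exists c, cdom jet c u.
Proof.
have idE t : on_chart (Chart setT (fun t : R => t)) (fun t => t) t = t.
  by rewrite -[X in on_chart _ _ X]/(Chart setT (fun t : R => t) t) on_chartE.
have ids : smooth_on setT
    (on_chart (Chart setT (fun t : R => t)) (fun t : R => t)).
  split=> [|k]; first exact: openT.
  apply: (@eq_Ck_on _ _ _ _ _ (idfun : R -> R)) => //; first exact: openT.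
  apply: (@Ck_on_linear _ _ _ _ _ (idfun : {linear R -> R})).
    exact: openT.
  by move=> x; exact: cvg_id.
have idt : time_chart (Chart setT (fun t : R => t)).
  split; first split=> //=.
  - exact: openT.
  - by move=> x _; exact: cvg_id.
  - by move=> U oU _; rewrite image_id.
  by split; rewrite /= setIT image_id.
have [c ac cx] := atlas_cover (base_pt u).2.
by exists (exist _ _ idt, exist _ c ac).
Qed.

Lemma base_inj c : set_inj (dom (base_chart c)) (base_chart c).
Proof.
move=> q q'; rewrite !inE => -[cq1 cq2] [cq'1 cq'2] /= [tE xE].
apply: injective_projections.
  exact: (@coord_inj _ _ _ time_atlas c.1).
exact: (@coord_inj _ _ _ position_atlas c.2).
Qed.

Lemma eq_trans_diff c d u (w w' : jet_model R n) :
  cdom jet c u -> cdom jet d u -> w.1 = w'.1 ->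
  ('d (trans c d) (jet_chart c u) w).1 = ('d (trans c d) (jet_chart c u) w').1.
Proof.
move=> cu du ww'; apply: injective_projections.
  apply: etrans (trans_time_diff w cu du) _; rewrite ww'.
  by apply: esym; exact: trans_time_diff.
apply/rowP => i; apply: etrans (trans_space_diff w i cu du) _; rewrite ww'.
by apply: esym; exact: trans_space_diff.
Qed.

(** [differential] computes in an arbitrarily chosen chart around [u]. In jet charts the projection
    is [fst] of the transition, and the tangency rule of [w] removes the choice. *)
Lemma differential_pi u (w : jet_tvec M) d :
  tangent u w -> differential (@pi_star R n M) u w d = (w d).1.
Proof.
move=> [w0 wT]; rewrite /differential; case: pselect; last first.
  by move=> h; have [c cu] := jet_cover u; case: h; exists c.
move=> ec; case: (cid ec) => c cu /=.
case: asboolP => [du|du]; last by rewrite w0.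
have dF : differentiable (trans c d) (jet_chart c u).
  exact: (@trans_differentiable _ _ _ jet_atlas).
have E : \forall z \near jet_chart c u, (fst \o trans c d) z =
    on_chart (jet_chart c) (fun y => base_chart d (base_pt y)) z.
  apply: filterS (near_overlap jet_atlas cu du) => z [y [cy dy] <-].
  by rewrite /= !(on_chartE _ (@jet_inj _ _ _ c) cy).
have dsF : differentiable (fst \o trans c d) (jet_chart c u).
  exact: (differentiable_comp dF
    (@linear_differentiable _ _ _ (@fst _ _) _ (fun z => cvg_fst))).
have [_ DE] := near_eq_diff E dsF.
apply: etrans (congr1 (fun f => f (w c)) DE) _.
apply: etrans (@diff_comp_linear _ _ _ _ (@fst _ _) _ _ _ (fun z => cvg_fst) dF) _.
by apply: (congr1 fst); apply: esym; exact: wT.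
Qed.

Lemma base_coord_vecE c d u (b : R * 'rV[R]_n) :
  cdom jet c u -> cdom jet d u ->
  @coord_vec R _ base c b (pi_star u) d =
  ('d (trans c d) (jet_chart c u) (b, 0)).1.
Proof.
move=> cu du; rewrite /coord_vec; case: asboolP => [_|[]//].
(* Freezing the momentum at that of [u] embeds base coordinates into jet coordinates; the base
   transition is then [fst] of the jet transition along this slice. *)
pose p := mom u c.
pose emb (x : R * 'rV[R]_n) : jet_model R n := (x, p).
have demb x : is_diff x emb (fun y => (y, 0)) by exact: is_diff_pair.
have embu : emb (base_chart c (base_pt u)) = jet_chart c u by [].
have dF : differentiable (trans c d) (emb (base_chart c (base_pt u))).
  exact: (@trans_differentiable _ _ _ jet_atlas).
have dFe := differentiable_comp (@ex_diff _ _ _ _ _ _ _ (demb _)) dF.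
have dsF : differentiable (fst \o (trans c d \o emb)) (base_chart c (base_pt u)).
  exact: (differentiable_comp dFe
    (@linear_differentiable _ _ _ (@fst _ _) _ (fun z => cvg_fst))).
have E : \forall x \near base_chart c (base_pt u), (fst \o (trans c d \o emb)) x =
    on_chart (base_chart c) (base_chart d) x.
  have cemb : {for base_chart c (base_pt u), continuous emb}.
    by apply: differentiable_continuous; exact: ex_diff.
  have nO : \forall x \near base_chart c (base_pt u), overlap c d (emb x) :=
    cemb _ (near_overlap jet_atlas cu du).
  apply: filterS nO => x [y [cy dy] yx].
  have -> : x = base_chart c (base_pt y) by have := congr1 fst yx.
  rewrite (on_chartE _ (@base_inj c) cy) /=.
  have -> : emb (base_chart c (base_pt y)) = jet_chart c y.
    by rewrite yx /emb; congr pair; have := congr1 fst yx.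
  by rewrite (on_chartE _ (@jet_inj _ _ _ c) cy).
have [_ DE] := near_eq_diff E dsF.
apply: etrans (congr1 (fun f => f b) DE) _.
apply: etrans (@diff_comp_linear _ _ _ _ (@fst _ _) _ _ _ (fun z => cvg_fst) dFe) _.
apply: (congr1 fst).
have De := diff_comp (@ex_diff _ _ _ _ _ _ _ (demb _)) dF.
apply: etrans (congr1 (fun f => f b) De) _.
rewrite /=; apply: (congr1 ('d (trans c d) (jet_chart c u))).
by have := @diff_val _ _ _ _ _ _ _ (demb (base_chart c (base_pt u))) => ->.
Qed.

(** Replaces the projection conditions on adapted fields by a condition in the one chart [c]; in
    other charts both sides transform by the same base block. *)
Lemma differential_piP c u (w : jet_tvec M) (b : R * 'rV[R]_n) :
  cdom jet c u -> tangent u w ->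
  differential (@pi_star R n M) u w = @coord_vec R _ base c b (pi_star u) <->
  (w c).1 = b.
Proof.
move=> cu Tw; split=> [E|wb].
  rewrite -(differential_pi c Tw) E base_coord_vecE//.
  by apply: etrans (congr1 fst (trans_refl jet_atlas cu _)) _.
apply/funext => d; rewrite differential_pi//; have [w0 wT] := Tw.
have [du|du] := pselect (cdom jet d u); last first.
  rewrite w0// /coord_vec; case: asboolP => // -[_].
  by move=> d'u; case: du.
rewrite base_coord_vecE//; apply: etrans (congr1 fst (wT c d cu du)) _.
exact: eq_trans_diff.
Qed.

Lemma verticalP c u (w : jet_tvec M) :
  cdom jet c u -> vertical u w <-> tangent u w /\ (w c).1 = 0.
Proof.
move=> cu; split=> [[Tw w0]|[Tw wc]]; split=> //.
  by rewrite -(differential_pi c Tw) w0.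
apply/funext => d; rewrite differential_pi//; have [w0 wT] := Tw.
have [du|du] := pselect (cdom jet d u); last by rewrite w0.
apply: etrans (congr1 fst (wT c d cu du)) _.
by rewrite (@eq_trans_diff c d u _ 0)// linear0.
Qed.

End Projection.

(** * Horizontal lifts *)

Section Horizontal.
Context {R : realType} {n : nat} {M : manifold R n}.
Implicit Types (c d e : jet_label M) (q : R * M) (u v : jet_space M).
Local Notation jet := (jet_space M).
Local Notation jtv := (tvec jet (jet_model R n)).

Lemma tvec_sumE (I : finType) (a : I -> R) (Y : I -> jtv) c :
  (\sum_i a i *: Y i) c = \sum_i a i *: Y i c.
Proof. by rewrite fct_sumE. Qed.

Section Lift.
Variable H : jet -> set (jtv).
Hypothesis hH : horizontal_distribution H.

Lemma horizontal_tangent u w : H u w -> tangent u w.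
Proof. by case: hH => -[h _] _; have [Ht _ _] := h u; exact: Ht. Qed.

Lemma horizontal0 u : H u 0.
Proof. by case: hH => -[h _] _; have [_ H0 _] := h u. Qed.

Lemma horizontal_comb u (a : R) w w' : H u w -> H u w' -> H u (a *: w + w').
Proof. by case: hH => -[h _] _; have [_ _] := h u; exact. Qed.

Lemma horizontal_sum u (I : finType) (a : I -> R) (Y : I -> jtv) :
  (forall i, H u (Y i)) -> H u (\sum_i a i *: Y i).
Proof.
move=> HY; elim/big_rec: _ => [|i w _ Hw]; first exact: horizontal0.
exact: horizontal_comb.
Qed.

(** The difference is horizontal and, with base component 0, also vertical. *)
Lemma horizontal_eq c u w w' : cdom jet c u -> H u w -> H u w' ->
  (w c).1 = (w' c).1 -> w = w'.
Proof.
move=> cu Hw Hw' ww'; case: hH => _ /(_ u)[_ HV].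
suff : [set 0] (w - w') by move/subr0_eq.
rewrite -HV; split.
  by rewrite -[w - w']addrC -scaleN1r; exact: horizontal_comb.
apply/(verticalP _ cu); split.
  by rewrite -[w - w']addrC -scaleN1r; apply: tangent_comb; exact: horizontal_tangent.
by rewrite !fctE raddfB /= ww' subrr.
Qed.

(** Any vector over [b] can be split, here the one with momentum component 0; removing its vertical
    part leaves the base component unchanged. *)
Lemma horizontal_lift c u (b : R * 'rV[R]_n) : cdom jet c u ->
  exists2 h, H u h & (h c).1 = b.
Proof.
move=> cu; case: hH => _ /(_ u)[HT _].
have := tangent_coord_vec jet_atlas ((b, 0) : jet_model R n) cu.
rewrite HT => -[h Hh [w /(verticalP _ cu)[_ wc] E]].
exists h => //; have := congr1 (fun f => (f c).1) E.
rewrite (coord_vec_id jet_atlas _ cu) !fctE /= => <-.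
by rewrite wc addr0.
Qed.

Definition hlift c b u : jtv :=
  xget 0 [set h | H u h /\ (h c).1 = b].

Lemma hliftP c b u : cdom jet c u -> H u (hlift c b u) /\ (hlift c b u c).1 = b.
Proof.
move=> cu; rewrite /hlift; case: xgetP => [h _ []//|].
by have [h Hh hb] := horizontal_lift b cu => /(_ h)[]; split.
Qed.

(* Base components as one row, so that those of a local frame form a matrix. *)
Definition pair_row (b : R * 'rV[R]_n) : 'rV[R]_(1 + n) := row_mx (b.1)%:M b.2.

Lemma pair_row_is_linear : linear pair_row.
Proof.
move=> a x y; rewrite /pair_row /= scale_row_mx add_row_mx.
congr row_mx; apply/rowP => i; rewrite !mxE.
by rewrite mulrnDl mulrnAr.
Qed.

HB.instance Definition _ :=
  GRing.isLinear.Build R (R * 'rV[R]_n)%type 'rV[R]_(1 + n) _ pair_row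
    pair_row_is_linear.

Lemma pair_rowZ (a : R) x j : pair_row (a *: x) 0 j = a * pair_row x 0 j.
Proof.
have -> : pair_row (a *: x) = a *: pair_row x by exact: linearZ.
by rewrite [LHS]mxE.
Qed.

Lemma pair_row_inj : injective pair_row.
Proof.
move=> [a x] [b y] /eq_row_mx[/(congr1 (fun A : 'M[R]_1 => A 0 0))].
by rewrite !mxE !mulr1n /= => -> ->.
Qed.

(** [hlift] is chosen point by point, so its smoothness has to come from the local smooth frames of
    [H]. *)
Lemma smooth_hlift c b :
  smooth_on (chart_of jet c @` cdom jet c)
            (on_chart (chart_of jet c) (fun u => hlift c b u c)).
Proof.
have oc : open (chart_of jet c @` cdom jet c).
  by have := @open_overlap _ _ _ c c; rewrite setIid.
split=> // k; apply: Ck_on_local => _ [u0 cu0 <-].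
have [[_ /(_ u0)[U [m [Y [oU Uu0 SY FY]]]]] _] := hH.
pose O := chart_of jet c @` (U `&` cdom jet c).
have oO : open O by exact: oU.
exists O; first by exists u0.
pose y i := on_chart (chart_of jet c) (fun u => Y i u c).
have yE i u : cdom jet c u -> y i (chart_of jet c u) = Y i u c.
  by move=> cu; rewrite /y (charted_onE jet_atlas).
(* Row [i] holds the base components of the frame field [Y i]; the rows are free because the
   projection is injective on [H], and span because it is onto. *)
pose A z : 'M[R]_(m, 1 + n) := \matrix_(i, j) pair_row (y i z).1 0 j.
have AE z i j : A z i j = pair_row (y i z).1 0 j by rewrite /A mxE.
have HY u i : U u -> H u (Y i u) by case: (SY i) => _; exact.
have mulA u (v : 'rV[R]_m) : cdom jet c u ->
    v *m A (chart_of jet c u) = pair_row ((\sum_i v 0 i *: Y i u) c).1.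
  move=> cu; rewrite tvec_sumE (raddf_sum fst) linear_sum.
  apply/rowP => j; rewrite mxE summxE; apply: eq_bigr => i _.
  by rewrite AE yE// [RHS]/= pair_rowZ.
have freeA u : U u -> cdom jet c u -> row_free (A (chart_of jet c u)).
  move=> Uu cu; apply: inj_row_free => v; rewrite mulA// => v0.
  have Sv : \sum_i v 0 i *: Y i u = 0.
    apply: (horizontal_eq cu) => //.
    - by apply: horizontal_sum => i; exact: HY.
    - exact: horizontal0.
    by apply: pair_row_inj; rewrite v0 linear0.
  have [/(_ (v 0) Sv) v0' _] := FY u Uu.
  by apply/rowP => i; rewrite mxE v0'.
have fullA u : U u -> cdom jet c u -> row_full (A (chart_of jet c u)).
  move=> Uu cu; rewrite -sub1mx; apply/row_subP => i.
  pose r : 'rV[R]_(1 + n) := row i 1%:M.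
  have [h Hh hE] := horizontal_lift ((lsubmx r) 0 0, rsubmx r) cu.
  have [_ /(_ h Hh)[a aE]] := FY u Uu.
  have rE : r = (\row_i a i) *m A (chart_of jet c u).
    rewrite mulA//; under eq_bigr do rewrite mxE.
    rewrite -aE hE /pair_row /= -mx11_scalar.
    by rewrite hsubmxK.
  by rewrite -/r rE submxMl.
(* The length of the local frame is not given. Row-free and row-full at [u0] together force it to be
   the dimension of the base, so that [A] becomes square. *)
have mE : m = (1 + n)%N.
  have := freeA _ Uu0 cu0; have := fullA _ Uu0 cu0.
  by rewrite /row_free /row_full => /eqP -> /eqP.
subst m.
have unitA z : O z -> A z \in unitmx.
  by move=> [u [Uu cu] <-]; rewrite -row_free_unit freeA.
have yC i : Ck_on k O (y i) by case: (SY i) => -[_ /(_ c)[_ CY]] _; exact: CY.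
have AC i j : Ck_on k O (fun z => A z i j).
  have aC : Ck_on k O (fun z => (y i z).1.1).
    exact: (@Ck_on_comp_linear _ k _ _ _ O (@fst _ _ \o @fst _ _) _ oO
      continuous_time_comp (yC i)).
  have bC : Ck_on k O (fun z => (y i z).1.2).
    exact: (@Ck_on_comp_linear _ k _ _ _ O (@snd _ _ \o @fst _ _) _ oO
      continuous_space_comp (yC i)).
  case: (split_ordP j) => j' jE.
    apply: eq_Ck_on aC => // z _.
    by rewrite AE jE row_mxEl mxE !ord1 eqxx mulr1n.
  apply: (@eq_Ck_on _ _ _ _ _ (fun z => (y i z).1.2 0 j')) => //.
    by move=> z _; rewrite AE jE row_mxEr.
  exact: Ck_on_coord.
(* The frame coefficients of the lift of [b]: the solution of [a z *m A z = pair_row b]. *)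
pose a z : 'rV[R]_(1 + n) := pair_row b *m invmx (A z).
apply: (@eq_Ck_on _ _ _ _ _ (fun z => \sum_i a z 0 i *: y i z)) => //.
  move=> _ [u [Uu cu] <-]; rewrite (charted_onE jet_atlas)//.
  have [Hl lb] := hliftP b cu.
  have -> : hlift c b u = \sum_i a (chart_of jet c u) 0 i *: Y i u.
    apply: (horizontal_eq cu) => //.
      by apply: horizontal_sum => i; exact: HY.
    apply: pair_row_inj; rewrite lb -mulA// mulmxKV//.
    by apply: unitA; exists u.
  by rewrite tvec_sumE; apply: eq_bigr => i _; rewrite yE.
apply: Ck_on_sum => // i _; apply: Ck_onZ => //.
apply: (@eq_Ck_on _ _ _ _ _ (fun z => \sum_j pair_row b 0 j * invmx (A z) j i)) => //.
  by move=> z _; rewrite mxE.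
apply: Ck_on_sum => // j _; apply: Ck_onM => //; first exact: Ck_on_cst.
exact: Ck_on_invmx.
Qed.

End Lift.
End Horizontal.

(** * Adapted fields, their coefficients, and horizontal spaces as graphs *)

Section Coefficients.
Context {R : realType} {n : nat} {M : manifold R n}.
Implicit Types (c d e : jet_label M) (q : R * M) (u v : jet_space M).
Local Notation jet := (jet_space M).
Local Notation jtv := (tvec jet (jet_model R n)).

Lemma tangent_sum u (I : finType) (a : I -> R) (Y : I -> jtv) :
  (forall i, tangent u (Y i)) -> tangent u (\sum_i a i *: Y i).
Proof.
move=> TY; elim/big_rec: _ => [|i w _ Tw]; first exact: tangent0.
exact: tangent_comb.
Qed.

Lemma sum_dir_p (a : 'I_n -> R) :
  \sum_j a j *: dir_p R j = (0, 0, \row_j a j) :> jet_model R n.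
Proof.
rewrite [X in (_, X)](row_sum_delta (\row_j a j)).
elim/big_rec2: _ => // i x y _ ->.
apply: injective_projections; last by rewrite /= mxE.
by apply: injective_projections; rewrite /= ?scaler0 addr0.
Qed.

(** Both sides are tangent at [u], so they agree once they agree in the chart [c], where each
    [coord_vec] is its own defining vector. *)
Lemma vertical_expansion c u (b : jet_model R n) (a : 'I_n -> R) (w : jtv) :
  cdom jet c u -> tangent u w ->
  w = @coord_vec R _ jet c b u - \sum_j a j *: @coord_vec R _ jet c (dir_p R j) u
  <-> w c = b - (0, 0, \row_j a j).
Proof.
move=> cu Tw.
have E : (@coord_vec R _ jet c b u
    - \sum_j a j *: @coord_vec R _ jet c (dir_p R j) u) c = b - (0, 0, \row_j a j).
  rewrite -sum_dir_p fctE [X in X - _](coord_vec_id jet_atlas)//.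
  congr (_ - _); apply: etrans (tvec_sumE _ _ _) _.
  by apply: eq_bigr => j _; rewrite (coord_vec_id jet_atlas).
split=> [->//|wc]; apply: (tangent_eq cu Tw); last by rewrite E.
rewrite addrC -scaleN1r; apply: tangent_comb; last exact: tangent_coord_vec jet_atlas _ _ _ _.
by apply: tangent_sum => j; exact: tangent_coord_vec jet_atlas _ _ _ _.
Qed.

Lemma adapted_lift (H : jet -> set jtv) c dt dx : horizontal_distribution H ->
  adapted_fields H c dt dx -> forall u, cdom jet c u ->
  [/\ H u (dt u), (dt u c).1 = (1, 0), forall i, H u (dx i u) &
      forall i, (dx i u c).1 = (0, delta_mx 0 i)].
Proof.
move=> hH [[_ Ht] Sx _ Pt Px] u cu; split.
- exact: Ht.
- apply/(differential_piP _ cu (horizontal_tangent hH (Ht u cu))); exact: Pt.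
- by move=> i; case: (Sx i) => _; exact.
- move=> i; have Hx : H u (dx i u) by case: (Sx i) => _; exact.
  by apply/(differential_piP _ cu (horizontal_tangent hH Hx)); exact: Px.
Qed.

Lemma tvec_combE (a : R) (t : jtv) (b : 'I_n -> R) (x : 'I_n -> jtv) c :
  (a *: t + \sum_i b i *: x i) c = a *: t c + \sum_i b i *: x i c.
Proof. by rewrite fctE tvec_sumE. Qed.

Lemma frame_components c u (t : jtv) (x : 'I_n -> jtv) :
  (t c).1 = (1, 0) -> (forall i, (x i c).1 = (0, delta_mx 0 i)) ->
  forall (a : R) (b : 'I_n -> R),
  ((a *: t + \sum_i b i *: x i) c).1 = (a, \row_i b i).
Proof.
move=> tc xc a b; rewrite tvec_combE raddfD /= (raddf_sum fst) tc.
rewrite [\sum_i _](eq_bigr (fun i => (0, b i *: delta_mx 0 i))); last first.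
  by move=> i _; rewrite /= xc; apply: injective_projections; rewrite /= ?scaler0.
have -> : \sum_i ((0, b i *: delta_mx 0 i) : R * 'rV[R]_n) = (0, \row_i b i).
  rewrite [X in (_, X)](row_sum_delta (\row_j b j)).
  elim/big_rec2: _ => // i y z _ ->.
  by apply: injective_projections; rewrite /= ?addr0 ?mxE.
apply: injective_projections; rewrite /= ?scaler0 ?add0r ?addr0//.
by rewrite [LHS]mulr1.
Qed.

(** Linear independence follows from the base components: those of a combination are its
    coefficients. *)
Lemma adapted_of_sections (H : jet -> set jtv) c dt dx :
  horizontal_distribution H ->
  smooth_section H (cdom jet c) dt ->
  (forall i, smooth_section H (cdom jet c) (dx i)) ->
  (forall u, cdom jet c u -> (dt u c).1 = (1, 0)) ->
  (forall i u, cdom jet c u -> (dx i u c).1 = (0, delta_mx 0 i)) ->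
  adapted_fields H c dt dx.
Proof.
move=> hH St Sx tE xE; split=> //.
- move=> u cu a b ab0.
  have := @frame_components c u (dt u) (dx^~ u) (tE u cu) (fun i => xE i u cu) a b.
  rewrite ab0 => -[a0 b0]; split=> // i.
  by have := congr1 (fun r : 'rV[R]_n => r 0 i) b0; rewrite !mxE.
- move=> u cu; have Ht : H u (dt u) by case: St => _; exact.
  by apply/(differential_piP _ cu (horizontal_tangent hH Ht)); exact: tE.
- move=> i u cu; have Hx : H u (dx i u) by case: (Sx i) => _; exact.
  by apply/(differential_piP _ cu (horizontal_tangent hH Hx)); exact: xE.
Qed.

Lemma hlift_section (H : jet -> set jtv) c b : horizontal_distribution H ->
  smooth_section H (cdom jet c) (hlift H c b).
Proof.
move=> hH; split=> [|u cu]; last by have [] := hliftP hH b cu.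
apply: (smooth_field_in_chart jet_model_frame jet_atlas (c := c)) => //.
  by move=> u cu; apply: (horizontal_tangent hH); have [] := hliftP hH b cu.
exact: smooth_hlift.
Qed.

Lemma adapted_hlift (H : jet -> set jtv) c : horizontal_distribution H ->
  adapted_fields H c (hlift H c (1, 0)) (fun i => hlift H c (0, delta_mx 0 i)).
Proof.
move=> hH; apply: adapted_of_sections => //; do ?[move=> i]; try exact: hlift_section.
  by move=> cu; have [] := hliftP hH (1, 0) cu.
by move=> u cu; have [] := hliftP hH (0, delta_mx 0 i) cu.
Qed.

Lemma adapted_eq (H : jet -> set jtv) c dt dx dt' dx' :
  horizontal_distribution H ->
  adapted_fields H c dt dx -> adapted_fields H c dt' dx' ->
  forall u, cdom jet c u -> dt' u = dt u /\ forall i, dx' i u = dx i u.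
Proof.
move=> hH A A' u cu.
have [Ht tE Hx xE] := adapted_lift hH A cu.
have [Ht' tE' Hx' xE'] := adapted_lift hH A' cu.
split=> [|i]; first by apply: (horizontal_eq hH cu) => //; rewrite tE tE'.
by apply: (horizontal_eq hH cu) => //; rewrite xE xE'.
Qed.

(** The coefficients are minus the momentum components of the adapted fields in [c]; existence,
    uniqueness and smoothness of the coefficients are all read off from this. *)
Lemma expansionP (H : jet -> set jtv) c dt dx N1 N2 :
  horizontal_distribution H -> adapted_fields H c dt dx ->
  expansion c dt dx N1 N2 <->
  forall u, cdom jet c u -> (dt u c).2 = - N1 u /\
    forall i j, (dx i u c).2 0 j = - N2 u j i.
Proof.
move=> hH A; split=> E u cu; have [Ht tE Hx xE] := adapted_lift hH A cu.
  have [Et Ex] := E u cu; split.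
    have /(vertical_expansion _ _ cu (horizontal_tangent hH Ht)) -> := Et.
    by rewrite /= sub0r; congr (- _); apply/rowP => j; rewrite mxE.
  move=> i j; have := Ex i.
  move/(vertical_expansion _ _ cu (horizontal_tangent hH (Hx i))) => ->.
  by rewrite /= !mxE sub0r.
have [Et Ex] := E u cu; split=> [|i].
  apply/(vertical_expansion _ _ cu (horizontal_tangent hH Ht)).
  rewrite [LHS]surjective_pairing tE Et.
  apply: injective_projections; last first.
    by rewrite /= sub0r; congr (- _); apply/rowP => j; rewrite mxE.
  by apply: injective_projections; rewrite /= subr0.
apply/(vertical_expansion _ _ cu (horizontal_tangent hH (Hx i))).
rewrite [LHS]surjective_pairing xE.
apply: injective_projections; last first.
  by apply/rowP => j; rewrite /= !mxE sub0r Ex.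
by apply: injective_projections; rewrite /= subr0.
Qed.

(** The common kernel of the forms dp_j + N1_j dt + N2_ji dx^i in the chart [c]. *)
Definition graph (N : coeffs M) c u (w : jtv) : Prop :=
  forall j, (w c).2 0 j =
    - (N.1 c u 0 j * (w c).1.1 + \sum_i N.2 c u j i * (w c).1.2 0 i).

Lemma graph_frame (N : coeffs M) c u (t : jtv) (x : 'I_n -> jtv) :
  (t c).2 = - N.1 c u -> (forall i j, (x i c).2 0 j = - N.2 c u j i) ->
  (t c).1 = (1, 0) -> (forall i, (x i c).1 = (0, delta_mx 0 i)) ->
  forall a b, graph N c u (a *: t + \sum_i b i *: x i).
Proof.
move=> tN xN tc xc a b j; have -> := frame_components u tc xc a b.
rewrite tvec_combE raddfD /= (raddf_sum snd) /= tN !mxE summxE opprD.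
congr (_ + _); first by rewrite mulrN mulrC.
rewrite -sumrN; apply: eq_bigr => i _.
by rewrite !mxE xN mulrN mulrC.
Qed.

Lemma graph_eq (N : coeffs M) c u (w w' : jtv) : cdom jet c u ->
  tangent u w -> tangent u w' -> graph N c u w -> graph N c u w' ->
  (w c).1 = (w' c).1 -> w = w'.
Proof.
move=> cu Tw Tw' Gw Gw' ww'; apply: (tangent_eq cu) => //.
apply: injective_projections => //.
by apply/rowP => j; rewrite Gw Gw' ww'.
Qed.

(** Recovers [H] from its coefficients in a single chart, whence the injectivity of the
    assignment. *)
Lemma coefficients_graph (H : jet -> set jtv) (N : coeffs M) c u w :
  horizontal_distribution H -> coefficients_of H N -> cdom jet c u ->
  H u w <-> tangent u w /\ graph N c u w.
Proof.
move=> hH [_ /(_ c)[dt [dx [A /(expansionP _ _ hH A) E]]]] cu.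
have [Ht tE Hx xE] := adapted_lift hH A cu; have [Nt Nx] := E u cu.
(* The combination of adapted fields with the base components of [w]: it lies both in [H u] and in
   the graph, so either membership of [w] forces [w = h]. *)
pose h := (w c).1.1 *: dt u + \sum_i (w c).1.2 0 i *: dx i u.
have Hh : H u h by apply: (horizontal_comb hH) => //; exact: horizontal_sum.
have hc : (h c).1 = (w c).1.
  rewrite (frame_components u tE xE) [RHS]surjective_pairing; congr pair.
  by apply/rowP => i; rewrite mxE.
have Gh : graph N c u h by exact: graph_frame.
split=> [Hw|[Tw Gw]].
  split; first exact: (horizontal_tangent hH).
  by rewrite (horizontal_eq hH cu Hw Hh).
by rewrite (@graph_eq N c u w h) => //; exact: (horizontal_tangent hH).
Qed.

Definition lift_coeffs (H : jet -> set jtv) : coeffs M :=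
  (fun c u => if `[< cdom jet c u >] then - (hlift H c (1, 0) u c).2 else 0,
   fun c u => if `[< cdom jet c u >]
     then \matrix_(j, i) - (hlift H c (0, delta_mx 0 i) u c).2 0 j else 0).

Lemma lift_coeffsP (H : jet -> set jtv) :
  horizontal_distribution H -> coefficients_of H (lift_coeffs H).
Proof.
move=> hH; split=> [c u cu|c].
  by rewrite /lift_coeffs /=; case: asboolP.
exists (hlift H c (1, 0)), (fun i => hlift H c (0, delta_mx 0 i)).
split; first exact: adapted_hlift.
apply/(expansionP _ _ hH (adapted_hlift c hH)) => u cu.
rewrite /lift_coeffs /=; case: asboolP => // _; split; first by rewrite opprK.
by move=> i j; rewrite mxE opprK.
Qed.

Lemma coefficients_unique (H : jet -> set jtv) (N N' : coeffs M) :
  horizontal_distribution H ->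
  coefficients_of H N -> coefficients_of H N' -> N = N'.
Proof.
move=> hH [SN CN] [SN' CN'].
have NN' c u : N.1 c u = N'.1 c u /\ N.2 c u = N'.2 c u.
  have [cu|cu] := pselect (cdom jet c u); last first.
    by have [-> ->] := SN c u cu; have [-> ->] := SN' c u cu.
  have [dt [dx [A /(expansionP _ _ hH A) E]]] := CN c.
  have [dt' [dx' [A' /(expansionP _ _ hH A') E']]] := CN' c.
  have [tt xx] := adapted_eq hH A A' cu.
  have [Nt Nx] := E u cu; have [Nt' Nx'] := E' u cu.
  split; first by apply: oppr_inj; rewrite -Nt -Nt' tt.
  by apply/matrixP => j i; apply: oppr_inj; rewrite -Nx -Nx' xx.
apply: injective_projections; apply/funext => c; apply/funext => u;
  by have [] := NN' c u.
Qed.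

Lemma coefficients_smooth (H : jet -> set jtv) (N : coeffs M) c :
  horizontal_distribution H -> coefficients_of H N ->
  smooth_fun (cdom jet c) (N.1 c) /\ smooth_fun (cdom jet c) (N.2 c).
Proof.
move=> hH [_ /(_ c)[dt [dx [A /(expansionP _ _ hH A) E]]]].
have [[[_ /(_ c) Ct] _] Sx _ _ _] := A; rewrite setIid in Ct.
have [oc _] := Ct.
have Cx i k : Ck_on k (chart_of jet c @` cdom jet c)
    (on_chart (chart_of jet c) (fun u => dx i u c)).
  have [[_ /(_ c) Cxi] _] := Sx i; rewrite setIid in Cxi.
  by case: Cxi.
have cs : continuous (@snd (R * 'rV[R]_n)%type 'rV[R]_n).
  by move=> z; exact: cvg_snd.
have cfun (W : normedModType R) (f : jet -> W) : smooth_on (chart_of jet c @` cdom jet c)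
    (on_chart (chart_of jet c) f) -> smooth_fun (cdom jet c) f.
  by apply: (smooth_fun_in_chart jet_model_frame jet_atlas (c := c)).
split; apply: cfun; split=> // k.
  apply: (@eq_Ck_on _ _ _ _ _ (fun z =>
    - (on_chart (chart_of jet c) (fun u => dt u c) z).2)) => //.
    move=> _ [u cu <-]; rewrite !(charted_onE jet_atlas)//.
    by have [-> _] := E u cu; rewrite opprK.
  apply: (@Ck_on_comp_linear _ _ _ _ _ _ (-%R : {linear _ -> _})) => //.
    by move=> z; exact: opp_continuous.
  by apply: (@Ck_on_comp_linear _ _ _ _ _ _ (@snd _ _)) => //; case: Ct.
apply: Ck_on_mx => // j i.
apply: (@eq_Ck_on _ _ _ _ _ (fun z =>
  - (on_chart (chart_of jet c) (fun u => dx i u c) z).2 0 j)) => //.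
  move=> _ [u cu <-]; rewrite !(charted_onE jet_atlas)//.
  by have [_ ->] := E u cu; rewrite opprK.
apply: (@Ck_on_comp_linear _ _ _ _ _ _ (-%R : {linear _ -> _})) => //.
  by move=> z; exact: opp_continuous.
by apply: Ck_on_coord => //; exact: (@Ck_on_comp_linear _ _ _ _ _ _ (@snd _ _)).
Qed.

End Coefficients.

(** * Nonlinear connections *)

Section Rules.
Context {R : realType} {n : nat} {M : manifold R n}.
Implicit Types (c d e : jet_label M) (q : R * M) (u v : jet_space M).
Local Notation jet := (jet_space M).
Local Notation jtv := (tvec jet (jet_model R n)).

(* The right-hand sides of the two transformation rules. *)
Definition new_N1 (N : coeffs M) c d u j : R :=
  \sum_k N.1 c u 0 k * dX d c (base_pt u) k j
  - dT d c (base_pt u) * dP c d (dir_t R n) u j.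

Definition new_N2 (N : coeffs M) c d u j r : R :=
  \sum_k \sum_i N.2 c u k i * dT c d (base_pt u)
    * dX d c (base_pt u) k j * dX d c (base_pt u) i r
  - \sum_i dX d c (base_pt u) i r * dP c d (dir_x R i) u j.

(** The right-hand sides of the rules are the coefficients of the old graph seen in the new chart,
    whatever [N] says in [d]; this serves both directions of the equivalence. *)
Lemma graph_change (N : coeffs M) c d u (w : jtv) : cdom jet c u -> cdom jet d u ->
  tangent u w -> graph N c u w ->
  forall j, (w d).2 0 j = - (new_N1 N c d u j * (w d).1.1 +
    \sum_r new_N2 N c d u j r * (w d).1.2 0 r).
Proof.
move=> cu du [_ wT] Gw j.
have [cu1 cu2] := cu; have [du1 du2] := du.
set T := dT c d (base_pt u); set T' := dT d c (base_pt u).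
set X := dX d c (base_pt u).
(* In the [N.1] term the factor [T] of the momenta meets the factor [T'] of the time component; they
   cancel, which is why the first rule has no time factor there. *)
have TT' : T * T' = 1 by rewrite -(dT_chain du1 cu1 du1) dT_refl.
have aE : (w c).1.1 = T' * (w d).1.1.
  by rewrite {1}(wT d c du cu); exact: trans_time_diff.
have bE i : (w c).1.2 0 i = \sum_r X i r * (w d).1.2 0 r.
  by rewrite {1}(wT d c du cu); exact: trans_space_diff.
have pE : (w d).2 0 j = (w c).1.1 * dP c d (dir_t R n) u j +
    \sum_i (w c).1.2 0 i * dP c d (dir_x R i) u j +
    \sum_k X k j * T * (w c).2 0 k.
  by rewrite {1}(wT c d cu du); exact: trans_mom_diff.
have E1 : \sum_k X k j * T * (w c).2 0 k =
    - (\sum_k N.1 c u 0 k * X k j) * (w d).1.1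
    - \sum_k \sum_i N.2 c u k i * T * X k j * (w c).1.2 0 i.
  rewrite mulNr mulr_suml -opprD -big_split -sumrN /=; apply: eq_bigr => k _.
  rewrite Gw aE mulrN; congr (- _); rewrite mulrDr mulr_sumr; congr (_ + _).
    have -> : X k j * T * (N.1 c u 0 k * (T' * (w d).1.1)) =
      N.1 c u 0 k * X k j * (w d).1.1 * (T * T') by ring.
    by rewrite TT' mulr1.
  by apply: eq_bigr => i _; ring.
(* By [bE] the sums over [r] reassemble the old space components, leaving the double sum of [E1] and
   the [dP] sum of [pE]. *)
have E2 : \sum_r new_N2 N c d u j r * (w d).1.2 0 r =
    \sum_k \sum_i N.2 c u k i * T * X k j * (w c).1.2 0 i
    - \sum_i (w c).1.2 0 i * dP c d (dir_x R i) u j.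
  under eq_bigr => r _ do rewrite mulrBl !mulr_suml.
  rewrite sumrB; congr (_ - _).
    rewrite exchange_big; apply: eq_bigr => k _ /=.
    under eq_bigr => r _ do rewrite mulr_suml.
    rewrite exchange_big; apply: eq_bigr => i _ /=.
    by rewrite bE mulr_sumr; apply: eq_bigr => r _; rewrite -/X -/T mulrA.
  rewrite exchange_big; apply: eq_bigr => i _ /=.
  by rewrite bE mulr_suml; apply: eq_bigr => r _; rewrite -/X; ring.
rewrite pE E1 E2 aE /new_N1 -/X -/T'; ring.
Qed.

Lemma transformation_rulesP (N : coeffs M) :
  transformation_rules N <-> forall c d u, cdom jet c u -> cdom jet d u ->
    (forall j, N.1 d u 0 j = new_N1 N c d u j) /\
    (forall j r, N.2 d u j r = new_N2 N c d u j r).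
Proof. by []. Qed.

Lemma graph_rules (N : coeffs M) c d u (w : jtv) : transformation_rules N ->
  cdom jet c u -> cdom jet d u -> tangent u w -> graph N c u w -> graph N d u w.
Proof.
move=> /transformation_rulesP/(_ c d u) TR cu du Tw Gw j.
have [T1 T2] := TR cu du.
rewrite (graph_change cu du Tw Gw) T1; congr (- (_ + _)).
by apply: eq_bigr => r _; rewrite T2.
Qed.

Lemma sum_delta (F : 'I_n -> R) r :
  \sum_i F i * (delta_mx 0 r : 'rV[R]_n) 0 i = F r.
Proof.
rewrite (bigD1 r)//= big1 ?addr0; first by rewrite mxE !eqxx mulr1.
by move=> i ir; rewrite mxE (negPf ir) andbF mulr0.
Qed.

(** In the chart [d] the same horizontal space is a graph twice over, by [N] and by the transformed
    coefficients. Testing on the lifts of the coordinate directions of [d] separates the individual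
    coefficients. *)
Lemma coefficients_rules (H : jet -> set jtv) (N : coeffs M) :
  horizontal_distribution H -> coefficients_of H N -> transformation_rules N.
Proof.
move=> hH CN; apply/transformation_rulesP => c d u cu du.
have key (h : jtv) (j : 'I_n) : H u h ->
    N.1 d u 0 j * (h d).1.1 + \sum_r N.2 d u j r * (h d).1.2 0 r =
    new_N1 N c d u j * (h d).1.1 + \sum_r new_N2 N c d u j r * (h d).1.2 0 r.
  move=> Hh; have [Th Gc] := (coefficients_graph h hH CN cu).1 Hh.
  have [_ Gd] := (coefficients_graph h hH CN du).1 Hh.
  by apply: oppr_inj; rewrite -Gd (graph_change cu du Th Gc).
split=> j; [|move=> r].
  have [h Hh hd] := horizontal_lift hH (1, 0) du.
  have := key h j Hh; rewrite hd /= !mulr1.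
  by rewrite !big1 ?addr0// => i _; rewrite mxE mulr0.
have [h Hh hd] := horizontal_lift hH (0, delta_mx 0 r) du.
have := key h j Hh; rewrite hd /= !mulr0 !add0r.
by rewrite !sum_delta.
Qed.

(** Asking for the graph in every chart avoids choosing one; by the rules one chart at [u] already
    suffices. *)
Definition connection_dist (N : coeffs M) u : set jtv :=
  [set w | tangent u w /\ forall c, cdom jet c u -> graph N c u w].

Section Connection.
Variable N : coeffs M.
Hypothesis hN : nonlinear_connection N.

Lemma connection_rules : transformation_rules N. Proof. by case: hN. Qed.

Lemma connection_distP c u w : cdom jet c u ->
  connection_dist N u w <-> tangent u w /\ graph N c u w.
Proof.
move=> cu; split=> -[Tw Gw]; split=> //; first exact: Gw.
by move=> d du; exact: (graph_rules connection_rules cu du).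
Qed.

Definition graph_vec c (b : R * 'rV[R]_n) u : jet_model R n :=
  (b, \row_j - (N.1 c u 0 j * b.1 + \sum_i N.2 c u j i * b.2 0 i)).

Definition graph_field c (b : R * 'rV[R]_n) u : jtv :=
  @coord_vec R _ jet c (graph_vec c b u) u.

Lemma graph_fieldE c b u : cdom jet c u -> graph_field c b u c = graph_vec c b u.
Proof. by move=> cu; rewrite /graph_field (coord_vec_id jet_atlas). Qed.

Lemma graph_field_dist c b u : cdom jet c u -> connection_dist N u (graph_field c b u).
Proof.
move=> cu; apply/(connection_distP _ cu); split.
  exact: (tangent_coord_vec jet_atlas).
by move=> j; rewrite graph_fieldE// mxE.
Qed.

Lemma connection_eq c u w w' : cdom jet c u ->
  connection_dist N u w -> connection_dist N u w' -> (w c).1 = (w' c).1 -> w = w'.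
Proof.
move=> cu [Tw Gw] [Tw' Gw']; apply: (graph_eq cu Tw Tw'); [exact: Gw|exact: Gw'].
Qed.

Lemma connection_comb u (a : R) w w' :
  connection_dist N u w -> connection_dist N u w' ->
  connection_dist N u (a *: w + w').
Proof.
move=> [Tw Gw] [Tw' Gw']; split=> [|c cu j]; first exact: tangent_comb.
have sE : \sum_i N.2 c u j i * ((a *: w + w') c).1.2 0 i =
    a * (\sum_i N.2 c u j i * (w c).1.2 0 i) + \sum_i N.2 c u j i * (w' c).1.2 0 i.
  rewrite mulr_sumr -big_split; apply: eq_bigr => i _ /=.
  by rewrite !mxE; ring.
have jE : ((a *: w + w') c).2 0 j = a * (w c).2 0 j + (w' c).2 0 j.
  by rewrite /= !mxE.
have tE : ((a *: w + w') c).1.1 = a * (w c).1.1 + (w' c).1.1 by [].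
rewrite sE jE tE (Gw c cu) (Gw' c cu); ring.
Qed.

Lemma connection0 u : connection_dist N u 0.
Proof.
split=> [|c cu j]; first exact: tangent0.
by rewrite /= mxE mulr0 add0r big1 ?oppr0// => i _; rewrite mxE mulr0.
Qed.

Lemma graph_field_section c b :
  smooth_section (connection_dist N) (cdom jet c) (graph_field c b).
Proof.
split=> [|u cu]; last exact: graph_field_dist.
apply: (smooth_field_in_chart jet_model_frame jet_atlas (c := c)) => //.
  by move=> u cu; case: (graph_field_dist b cu).
have [_ /(_ c)[/(_ c) S1 /(_ c) S2] _] := hN; rewrite !setIid in S1 S2.
have [oc C1] := S1; have [_ C2] := S2; split=> // k.
pose f1 := on_chart (chart_of jet c) (N.1 c).
pose f2 := on_chart (chart_of jet c) (N.2 c).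
apply: (@eq_Ck_on _ _ _ _ _ (fun z => (b, \row_j ((-1) *
   (f1 z 0 j * b.1 + \sum_i f2 z j i * b.2 0 i))) : jet_model R n)) => //.
  move=> _ [u cu <-]; rewrite /f1 /f2 !(charted_onE jet_atlas)// graph_fieldE//.
  by congr pair; apply/rowP => j; rewrite !mxE mulN1r.
apply: Ck_on_pair => //; first exact: Ck_on_cst.
apply: Ck_on_mx => // j0 j.
apply: (@eq_Ck_on _ _ _ _ _ (fun z => (-1) *
   (f1 z 0 j * b.1 + \sum_i f2 z j i * b.2 0 i))) => //.
  by move=> z _; rewrite mxE.
apply: Ck_onM => //; first exact: Ck_on_cst.
apply: Ck_onD => //.
  by apply: Ck_onM; [|exact: Ck_on_coord|exact: Ck_on_cst].
by apply: Ck_on_sum => // i _; apply: Ck_onM; [|exact: Ck_on_coord|exact: Ck_on_cst].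
Qed.

(** Smooth distributions require one indexed frame, so time takes index [ord0] and the space
    directions the lifted indices. *)
Definition frame_dir (i : 'I_n.+1) : R * 'rV[R]_n :=
  if unlift ord0 i is Some j then (0, delta_mx 0 j) else (1, 0).

Lemma sum_frame_dir (a : 'I_n.+1 -> R) :
  \sum_i a i *: frame_dir i = (a ord0, \row_j a (lift ord0 j)).
Proof.
rewrite big_ord_recl /frame_dir unlift_none.
under eq_bigr do rewrite liftK.
have -> : \sum_(j < n) a (lift ord0 j) *: ((0, delta_mx 0 j) : R * 'rV[R]_n) =
    (0, \row_j a (lift ord0 j)).
  rewrite [X in (_, X)](row_sum_delta (\row_j a (lift ord0 j))).
  elim/big_rec2: _ => // i y z _ ->.
  by apply: injective_projections; rewrite /= ?scaler0 ?addr0 ?mxE.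
apply: injective_projections; rewrite /= ?scaler0 ?add0r ?addr0//.
by rewrite [LHS]mulr1.
Qed.

Lemma connection_smooth : smooth_distribution (connection_dist N).
Proof.
split=> [u|u].
  split; [by move=> w []|exact: connection0|move=> a v w].
  exact: connection_comb.
have [c cu] := jet_cover u.
exists (cdom jet c), n.+1, (fun i => graph_field c (frame_dir i)).
split=> //.
- move=> d; apply: (open_image_chart jet_atlas (c := c)) => //.
  by have := @open_overlap _ _ _ c c; rewrite setIid.
- by move=> i; exact: graph_field_section.
move=> y cy.
have fstE (a : 'I_n.+1 -> R) :
    ((\sum_i a i *: graph_field c (frame_dir i) y) c).1 =
    (a ord0, \row_j a (lift ord0 j)).
  rewrite tvec_sumE (raddf_sum fst) -sum_frame_dir; apply: eq_bigr => i _.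
  by rewrite /= graph_fieldE.
have distS (a : 'I_n.+1 -> R) :
    connection_dist N y (\sum_i a i *: graph_field c (frame_dir i) y).
  elim/big_rec: _ => [|i w _ Hw]; first exact: connection0.
  by apply: connection_comb => //; exact: graph_field_dist.
split=> [a a0 i|w Hw].
  have := fstE a; rewrite a0 => -[a00 aS].
  case: (unliftP ord0 i) => [j|] -> //.
  by have := congr1 (fun r : 'rV[R]_n => r 0 j) aS; rewrite !mxE.
(* The frame projects to the coordinate basis, so the frame coefficients of [w] are its base
   components. *)
exists (fun i => if unlift ord0 i is Some j then (w c).1.2 0 j else (w c).1.1).
apply: (connection_eq cy) => //; rewrite fstE unlift_none.
rewrite [LHS]surjective_pairing; congr pair.
by apply/rowP => j; rewrite mxE liftK.
Qed.

Lemma connection_horizontal : horizontal_distribution (connection_dist N).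
Proof.
split=> [|u]; first exact: connection_smooth.
have [c cu] := jet_cover u; split.
  apply/seteqP; split=> [w Tw|_ [h [Th _] [w /(verticalP _ cu)[Tw _] <-]]].
    (* The horizontal part of [w]: the point of the graph over its base components. *)
    pose h := graph_field c (w c).1 u.
    have Hh : connection_dist N u h by exact: graph_field_dist.
    exists h => //; exists (w - h); last by rewrite addrC subrK.
    apply/(verticalP _ cu); split.
      rewrite -[w - h]addrC -scaleN1r; apply: tangent_comb => //.
      by case: Hh.
    have hc : (h c).1 = (w c).1 by rewrite /h graph_fieldE.
    by rewrite !fctE raddfB /= hc subrr.
  by rewrite -[h]scale1r; exact: tangent_comb.
apply/seteqP; split=> [w [Hw /(verticalP _ cu)[Tw w0]]|_ ->].
  by apply: (connection_eq cu Hw (connection0 u)); rewrite w0.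
split; first exact: connection0.
by apply/(verticalP _ cu); split=> //; exact: tangent0.
Qed.

Lemma connection_coefficients : coefficients_of (connection_dist N) N.
Proof.
have hH := connection_horizontal.
split=> [|c]; first by case: hN.
exists (graph_field c (1, 0)), (fun i => graph_field c (0, delta_mx 0 i)).
have A : adapted_fields (connection_dist N) c (graph_field c (1, 0))
    (fun i => graph_field c (0, delta_mx 0 i)).
  apply: adapted_of_sections => //.
  - exact: graph_field_section.
  - by move=> i; exact: graph_field_section.
  - by move=> u cu; rewrite /= graph_fieldE.
  - by move=> i u cu; rewrite /= graph_fieldE.
split=> //; apply/(expansionP _ _ hH A) => u cu; split=> [|i j].
  rewrite graph_fieldE//; apply/rowP => j; rewrite !mxE mulr1.
  by rewrite big1 ?addr0// => i _; rewrite mxE mulr0.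
by rewrite graph_fieldE// mxE /= mulr0 add0r sum_delta.
Qed.

End Connection.

Lemma coefficients_connection (H : jet -> set jtv) (N : coeffs M) :
  horizontal_distribution H -> coefficients_of H N -> nonlinear_connection N.
Proof.
move=> hH CN; split; first by case: CN.
  by move=> c; exact: coefficients_smooth CN.
exact: coefficients_rules CN.
Qed.

End Rules.

(** * The correspondence of horizontal distributions and nonlinear connections *)

Theorem theorem21 (R : realType) (n : nat) (M : manifold R n) :
  (forall H : jet_space M -> set (jet_tvec M), horizontal_distribution H ->
    (* (i) *)
    (forall c : jet_label M,
      exists (dt : jet_space M -> jet_tvec M)
             (dx : 'I_n -> jet_space M -> jet_tvec M),
        adapted_fields H c dt dx /\
        forall dt' dx', adapted_fields H c dt' dx' ->
          forall u, cdom (jet_space M) c u ->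
            dt' u = dt u /\ forall i, dx' i u = dx i u) /\
    (* (ii) *)
    (forall (c : jet_label M) (dt : jet_space M -> jet_tvec M)
            (dx : 'I_n -> jet_space M -> jet_tvec M),
      adapted_fields H c dt dx ->
      exists (N1 : jet_space M -> 'rV[R]_n) (N2 : jet_space M -> 'M[R]_n),
        expansion c dt dx N1 N2 /\
        forall N1' N2', expansion c dt dx N1' N2' ->
          forall u, cdom (jet_space M) c u -> N1' u = N1 u /\ N2' u = N2 u) /\
    (* (iii) *)
    (forall N : coeffs M, coefficients_of H N -> transformation_rules N)) /\
  (* (iv) *)
  (exists Phi : (jet_space M -> set (jet_tvec M)) -> coeffs M,
    (forall H, horizontal_distribution H -> coefficients_of H (Phi H)) /\
    set_bij [set H | horizontal_distribution H]
            [set N | nonlinear_connection N] Phi).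
Proof.
split=> [H hH|].
  split; last split.
  - move=> c; exists (hlift H c (1, 0)), (fun i => hlift H c (0, delta_mx 0 i)).
    have A := adapted_hlift c hH; split=> // dt dx A' u cu.
    exact: (adapted_eq hH A A').
  - move=> c dt dx A.
    pose N1 u := - (dt u c).2; pose N2 u := \matrix_(j, i) - (dx i u c).2 0 j.
    have E0 u : cdom (jet_space M) c u -> (dt u c).2 = - N1 u /\
        forall i j, (dx i u c).2 0 j = - N2 u j i.
      by split=> [|i j]; rewrite ?mxE opprK.
    exists N1, N2; split; first exact/(expansionP _ _ hH A).
    move=> N1' N2' /(expansionP _ _ hH A) E u cu.
    have [Et Ex] := E u cu; have [Et0 Ex0] := E0 u cu.
    split; first by apply: oppr_inj; rewrite -Et -Et0.
    by apply/matrixP => j i; apply: oppr_inj; rewrite -Ex -Ex0.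
  - by move=> N; exact: coefficients_rules.
(* [lift_coeffs] vanishes off the chart domains, so that uniqueness on the domains becomes equality
   of families. *)
exists (@lift_coeffs R n M); split; first exact: lift_coeffsP.
split.
- move=> H hH; exact: coefficients_connection (lift_coeffsP hH).
- move=> H H'; rewrite !inE => hH hH' HH'.
  apply/funext => u; have [c cu] := jet_cover u.
  (* Now [H] and [H'] share their coefficients, and both are the graph of these in the chart [c]. *)
  have C := lift_coeffsP hH; rewrite HH' in C.
  apply/seteqP; split=> w.
    move/(coefficients_graph w hH C cu).
    by move/(coefficients_graph w hH' (lift_coeffsP hH') cu).
  move/(coefficients_graph w hH' (lift_coeffsP hH') cu).
  by move/(coefficients_graph w hH C cu).
- move=> N hN; exists (connection_dist N); first exact: connection_horizontal.
  (* Both [N] and the chosen coefficients are coefficients of [connection_dist N], hence equal. *)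
  apply: (coefficients_unique (connection_horizontal hN)).
    exact: lift_coeffsP (connection_horizontal hN).
  exact: connection_coefficients.
Qed.
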